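(* Let $X$ be an infinite-dimensional complex Banach space and let $T\in\mathcal{B}(X)$. If $T$ or its dual $T^*$ has the single-valued extension property on $\mathbb{C}\setminus\sigma_W(T)$, then $T$ satisfies property $(Z_{\Pi_a})$ if and only if $\Pi_a(T)=\Pi^0(T)$.
   Context: $\mathcal{B}(X)$ is the algebra of bounded linear operators on $X$ and $I$ is the identity; $T^*\in\mathcal{B}(X^* )$ is the dual operator. For $S\in\mathcal{B}(X)$, $\mathcal{N}(S)$ and $\mathcal{R}(S)$ are its null space and range, $\sigma(S)$ its spectrum, and $\sigma_a(S)$ its approximate point spectrum ($\lambda\in\sigma_a(S)$ iff $S-\lambda I$ is not bounded below). $S\in\mathcal{B}(X)$ is Fredholm if $\dim\mathcal{N}(S)<\infty$ and $\operatorname{codim}\mathcal{R}(S)<\infty$, with index $\dim\mathcal{N}(S)-\operatorname{codim}\mathcal{R}(S)$; it is Weyl if it is Fredholm of index $0$. The Weyl spectrum is $\sigma_W(T)=\{\lambda\in\mathbb{C}: T-\lambda I \text{ is not Weyl}\}$. A bounded operator $S$ on a complex Banach space $Y$ has the single-valued extension property (SVEP) at $\lambda\in\mathbb{C}$ if for every open neighborhood $U_\lambda$ of $\lambda$, the function $f\equiv 0$ is the only analytic function $f:U_\lambda\to Y$ satisfying $(S-\mu I)f(\mu)=0$ for all $\mu\in U_\lambda$. $S$ has SVEP on $A\subset\mathbb{C}$ if it has SVEP at every $\lambda\in A$. The ascent and descent of $S$ are $a(S)=\inf\{n\in\mathbb{N}:\mathcal{N}(S^n)=\mathcal{N}(S^{n+1})\}$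 and $\delta(S)=\inf\{n\in\mathbb{N}:\mathcal{R}(S^n)=\mathcal{R}(S^{n+1})\}$, with $\mathbb{N}=\{0,1,2,\dots\}$ and $\inf\emptyset=\infty$. $\lambda\in\sigma(T)$ is a pole of $T$ if $T-\lambda I$ has finite ascent and finite descent; it is of finite rank if $\dim\mathcal{N}(T-\lambda I)<\infty$. $\lambda\in\sigma_a(T)$ is a left pole of $T$ if $a(T-\lambda I)<\infty$ and $\mathcal{R}((T-\lambda I)^{a(T-\lambda I)+1})$ is closed. $\Pi^0(T)$ is the set of poles of $T$ of finite rank and $\Pi_a(T)$ the set of left poles of $T$. $T$ satisfies property $(Z_{\Pi_a})$ if $\sigma(T)\setminus\sigma_W(T)=\Pi_a(T)$. *)

(* Defs.v *)
From HB Require Import structures.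
From mathcomp Require Import all_boot all_order all_algebra complex.
From mathcomp Require Import all_classical all_reals.
From mathcomp Require Import topology normedtype sequences.

Set Implicit Arguments.
Unset Strict Implicit.
Unset Printing Implicit Defensive.

Import Order.TTheory GRing.Theory Num.Theory.
Import numFieldNormedType.Exports.

Local Open Scope classical_set_scope.
Local Open Scope ring_scope.
Local Open Scope complex_scope.

(* [R[i]] bundled as a [numClosedFieldType]: stated this way, the topology and
   the normed module structure that the library puts on any such field are
   found by unification. *)
Definition Cplx (R : realType) : numClosedFieldType := R[i].

Section BoundedOperators.
Variables (R : realType) (X Y : normedModType (Cplx R)).

Definition bounded_linear (f : X -> Y) : Prop :=
  linear f /\ exists M : Cplx R, forall x, `|f x| <= M * `|x|.

Definition bop_pred : {pred X -> Y} := [pred f | `[< bounded_linear f >]].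

Lemma bop_submod_closed : submod_closed bop_pred.
Proof.
split.
  apply/asboolP; split; first by move=> a x y; rewrite scaler0 addr0.
  by exists 0 => x; rewrite normr0 mul0r.
move=> a f g /asboolP[lf [M fM]] /asboolP[lg [N gN]]; apply/asboolP; split.
  move=> b x y; rewrite !fctE lf lg !scalerDr !scalerA mulrC.
  by rewrite addrACA.
exists (`|a| * M + N) => x; rewrite !fctE (le_trans (ler_normD _ _))//.
by rewrite mulrDl lerD// normrZ -mulrA ler_wpM2l.
Qed.

HB.instance Definition _ :=
  GRing.isSubmodClosed.Build (Cplx R) (X -> Y) bop_pred bop_submod_closed.

Record bop := Bop { bop_val :> X -> Y; bop_valP : bop_val \in bop_pred }.

HB.instance Definition _ := [isSub for bop_val].
HB.instance Definition _ := [Choice of bop by <:].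
HB.instance Definition _ := [SubChoice_isSubLmodule of bop by <:].

Lemma bopP (f g : bop) : (forall x, f x = g x) -> f = g.
Proof. by move=> fg; apply: val_inj; apply/funext. Qed.

Lemma mem_bop (f : X -> Y) : bounded_linear f -> f \in bop_pred.
Proof. by move=> /asboolP. Qed.

Lemma bop_bounded (f : bop) : bounded_linear f.
Proof. exact/asboolP/bop_valP. Qed.

Lemma bop_linear (f : bop) : linear f.
Proof. by have [] := bop_bounded f. Qed.

Lemma bopD (f g : bop) x : (f + g) x = f x + g x.
Proof. by []. Qed.

Lemma bopZ a (f : bop) x : (a *: f) x = a *: f x.
Proof. by []. Qed.

Lemma bopZr (f : bop) a x : f (a *: x) = a *: f x.
Proof.
have f0 : f 0 = 0.
  by have := bop_linear f (-1) 0 0; rewrite scaler0 addr0 scaleN1r addNr.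
by have := bop_linear f a x 0; rewrite f0 !addr0.
Qed.

Definition opnorm (f : bop) : Cplx R :=
  (sup [set complex.Re `|f x| | x in [set x : X | `|x| <= 1]])%:C.

Lemma ReK_ge0 (z : Cplx R) : 0 <= z -> (complex.Re z)%:C = z.
Proof. by move=> z0; apply: RRe_real; exact: ger0_real. Qed.

Lemma bop_bounded_ge0 (f : bop) :
  exists2 M : Cplx R, 0 <= M & forall x, `|f x| <= M * `|x|.
Proof.
have [_ [M fM]] := bop_bounded f; exists `|M| => // x.
by rewrite -[X in _ * X]normr_id -normrM ger0_norm// (le_trans _ (fM x)).
Qed.

Lemma opnorm_has_sup (f : bop) :
  has_sup [set complex.Re `|f x| | x in [set x : X | `|x| <= 1]].
Proof.
split; first by exists (complex.Re `|f 0|), 0 => //=; rewrite normr0.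
have [M M0 fM] := bop_bounded_ge0 f.
exists (complex.Re M) => _ [x /= x1 <-]; rewrite -lecR !ReK_ge0//.
by rewrite (le_trans (fM x))// ler_piMr.
Qed.

Lemma opnorm_ge0 (f : bop) : 0 <= opnorm f.
Proof.
rewrite /opnorm lecR; have [_ ub] := opnorm_has_sup f.
apply: (@le_trans _ _ (complex.Re `|f 0|)).
  by rewrite -lecR ReK_ge0 ?normr_ge0.
by apply: ub_le_sup => //; exists 0 => //=; rewrite normr0.
Qed.

Lemma le_opnorm (f : bop) x : `|f x| <= opnorm f * `|x|.
Proof.
have [->|x0] := eqVneq x 0.
  by have := bopZr f 0 0; rewrite !scale0r => ->; rewrite !normr0 mulr0.
have nx0 : 0 < `|x| by rewrite normr_gt0.
rewrite -ler_pdivrMr//.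
have -> : `|f x| / `|x| = `|f (`|x|^-1 *: x)|.
  by rewrite bopZr normrZ normfV normr_id mulrC.
rewrite -[leLHS]ReK_ge0// /opnorm lecR.
apply: ub_le_sup; first by have [] := opnorm_has_sup f.
exists (`|x|^-1 *: x) => //=.
by rewrite normrZ normfV normr_id mulVf// gt_eqF.
Qed.

Lemma opnorm_le (f : bop) (M : Cplx R) :
  0 <= M -> (forall x, `|f x| <= M * `|x|) -> opnorm f <= M.
Proof.
move=> M0 fM; rewrite -[M]ReK_ge0// /opnorm lecR.
apply: ge_sup; first by have [] := opnorm_has_sup f.
move=> _ [x /= x1 <-]; rewrite -lecR !ReK_ge0//.
by rewrite (le_trans (fM x))// ler_piMr.
Qed.

Lemma opnormD (f g : bop) : opnorm (f + g) <= opnorm f + opnorm g.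
Proof.
apply: opnorm_le; first by rewrite addr_ge0// opnorm_ge0.
move=> x; rewrite bopD (le_trans (ler_normD _ _))// mulrDl.
by rewrite lerD// le_opnorm.
Qed.

Lemma opnormZ_le (a : Cplx R) (f : bop) : opnorm (a *: f) <= `|a| * opnorm f.
Proof.
apply: opnorm_le; first by rewrite mulr_ge0// opnorm_ge0.
by move=> x; rewrite bopZ normrZ -mulrA ler_wpM2l// le_opnorm.
Qed.

Lemma opnormZ (a : Cplx R) (f : bop) : opnorm (a *: f) = `|a| * opnorm f.
Proof.
apply/eqP; rewrite eq_le opnormZ_le/=.
have [->|a0] := eqVneq a 0; first by rewrite normr0 mul0r opnorm_ge0.
rewrite -ler_pdivlMl ?normr_gt0// -normfV.
by rewrite -[X in opnorm X](scalerK a0) opnormZ_le.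
Qed.

Lemma opnorm0_eq0 (f : bop) : opnorm f = 0 -> f = 0.
Proof.
move=> f0; apply: bopP => x; apply/eqP; rewrite -normr_le0.
by rewrite (le_trans (le_opnorm f x))// f0 mul0r.
Qed.

HB.instance Definition _ :=
  Lmodule_isNormed.Build (Cplx R) bop opnormD opnormZ opnorm0_eq0.

End BoundedOperators.

Section Composition.
Variables (R : realType) (X Y Z : normedModType (Cplx R)).

Lemma bounded_linear_id : bounded_linear (@id X).
Proof. by split=> //; exists 1 => x; rewrite mul1r. Qed.

Definition idb : bop X X := Bop (mem_bop bounded_linear_id).

Lemma bounded_linear_comp (g : bop Y Z) (f : bop X Y) :
  bounded_linear (g \o f).
Proof.
split; first by move=> a x y /=; rewrite !bop_linear.
exists (opnorm g * opnorm f) => x /=.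
rewrite (le_trans (le_opnorm _ _))// -mulrA ler_wpM2l ?opnorm_ge0//.
exact: le_opnorm.
Qed.

Definition compb (g : bop Y Z) (f : bop X Y) : bop X Z :=
  Bop (mem_bop (bounded_linear_comp g f)).

End Composition.

Arguments idb {R} X.

Notation dual X := (bop X (Cplx _)).

Section DualOperator.
Variables (R : realType) (X : normedModType (Cplx R)) (T : bop X X).

Lemma bounded_linear_dual : bounded_linear (fun f : dual X => compb f T).
Proof.
split; first by move=> a f g; apply: bopP => x.
exists (opnorm T) => f; apply: opnorm_le.
  by rewrite mulr_ge0// opnorm_ge0.
move=> x /=; rewrite (le_trans (le_opnorm _ _))// [opnorm T * _]mulrC -mulrA.
by rewrite ler_wpM2l ?opnorm_ge0// le_opnorm.
Qed.

Definition dual_op : bop (dual X) (dual X) :=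
  Bop (mem_bop bounded_linear_dual).

End DualOperator.

Section OperatorTheory.
Variables (R : realType) (X : normedModType (Cplx R)).
Implicit Types (S T : bop X X) (V : set X).

Definition has_dim V (n : nat) : Prop :=
  exists e : 'I_n -> X, (forall i, V (e i)) /\
    forall x, V x -> exists! c : 'rV[Cplx R]_n, x = \sum_(i < n) c ord0 i *: e i.

(* [e] induces a basis of the quotient [X / V] *)
Definition has_codim V (n : nat) : Prop :=
  exists e : 'I_n -> X,
    forall x, exists! c : 'rV[Cplx R]_n, V (x - \sum_(i < n) c ord0 i *: e i).

Definition finite_dim V : Prop := exists n, has_dim V n.
Definition finite_codim V : Prop := exists n, has_codim V n.

Definition null_space (f : X -> X) : set X := [set x | f x = 0].

Definition fredholm S : Prop :=
  finite_dim (null_space S) /\ finite_codim (range S).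

Definition has_index S (k : int) : Prop :=
  exists n m : nat, [/\ has_dim (null_space S) n, has_codim (range S) m &
    k = n%:Z - m%:Z].

Definition weyl S : Prop := fredholm S /\ has_index S 0.

(* [None] stands for infinity, the infimum of the empty set *)
Definition inf_nat (P : nat -> Prop) : option nat :=
  if pselect (exists n, `[< P n >]) is left h then Some (ex_minn h) else None.

Definition ascent S : option nat :=
  inf_nat (fun n => null_space (iter n S) = null_space (iter n.+1 S)).

Definition descent S : option nat :=
  inf_nat (fun n => range (iter n S) = range (iter n.+1 S)).

Definition invertible S : Prop :=
  exists S' : bop X X, compb S S' = idb X /\ compb S' S = idb X.

Definition bounded_below S : Prop :=
  exists2 c : Cplx R, 0 < c & forall x, c * `|x| <= `|S x|.

Definition shift T (l : Cplx R) : bop X X := T - l *: idb X.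

Definition spectrum T : set (Cplx R) := [set l | ~ invertible (shift T l)].

Definition approx_point_spectrum T : set (Cplx R) :=
  [set l | ~ bounded_below (shift T l)].

Definition weyl_spectrum T : set (Cplx R) := [set l | ~ weyl (shift T l)].

Definition pole T (l : Cplx R) : Prop :=
  [/\ spectrum T l, ascent (shift T l) <> None & descent (shift T l) <> None].

Definition finite_rank_poles T : set (Cplx R) :=
  [set l | pole T l /\ finite_dim (null_space (shift T l))].

Definition left_poles T : set (Cplx R) :=
  [set l | approx_point_spectrum T l /\
    exists2 a : nat, ascent (shift T l) = Some a &
      closed (range (iter a.+1 (shift T l)))].

Definition property_ZPia T : Prop :=
  spectrum T `\` weyl_spectrum T = left_poles T.

(* Analyticity is taken in the Weierstrass sense: [f] has a norm-convergent
   power series expansion around each point of [U]. *)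
Definition analytic_on (U : set (Cplx R)) (f : Cplx R -> X) : Prop :=
  forall l, U l -> exists a : nat -> X, \forall m \near l,
    series (fun n => (m - l) ^+ n *: a n) @ \oo --> f m.

Definition SVEP_at S (l : Cplx R) : Prop :=
  forall U : set (Cplx R), open U -> U l ->
  forall f : Cplx R -> X, analytic_on U f ->
    (forall m, U m -> shift S m (f m) = 0) -> forall m, U m -> f m = 0.

Definition SVEP_on S (A : set (Cplx R)) : Prop :=
  forall l, A l -> SVEP_at S l.

End OperatorTheory.

(* Main.v *)
From HB Require Import structures.
From mathcomp Require Import all_boot all_order all_algebra complex.
From mathcomp Require Import all_classical all_reals.
From mathcomp Require Import topology normedtype sequences.
From mathcomp Require Import ring lra.
Require Import Defs.

(** Put S = T - l.  Under either extension hypothesis the set of spectral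
    values that lie outside the Weyl spectrum is exactly the set of poles of
    finite rank; the asserted equivalence is then a substitution of equal sets.

    A pole of finite rank lies outside the Weyl spectrum because, when ascent
    and descent are finite, X is the direct sum of N(S^r) and R(S^r) for large
    r; S is bijective on the second summand and is a square matrix on the
    finite-dimensional first one, where kernel and cokernel have the same
    dimension ([pole_index0]).

    Conversely let S be Weyl.  Index zero passes to compositions
    ([index0_comp]), hence to every power P = S^n.  For such a P the conditions
    that N(P) and R(P) meet trivially and that they span X both say that the
    square matrix of the map from N(P) to X / R(P) is invertible
    ([index0_square]).  So finite ascent and finite descent are equivalent, and
    it suffices to get one of them from the extension property.

    Suppose T has the property at l.  The spaces N(S) /\ R(S^n) decrease in
    finite dimension, so they are constant from some n on.  If the final space
    contained x_0 <> 0, one could choose x_1, x_2, ... with S x_(k+1) = x_k and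
    geometric growth: a vector y of the intersection of all ranges is
    S^(n+1) v with |v| <= C |y| by the open mapping theorem, and S^n v again
    lies in that intersection by the choice of n.  The sum of the
    (m - l)^k x_k would be an analytic solution of (T - m) f(m) = 0 with
    f(l) = x_0.  Hence the final space is zero and S has finite ascent
    ([no_chain_ascent]).

    The same argument runs on the dual operator, without the Hahn-Banach
    theorem: the coordinate functionals of X modulo the finite-codimensional
    range of S^n are bounded by the open mapping theorem ([codim_coordinates]).
    They span the null space of the dual operator, they provide bounded lifts
    for its powers, and they turn its finite ascent into finite descent of S
    ([dual_ascent_range]).

    Since the norm of a complex normed module takes values in the complex
    field, estimates are carried out with its real part [nrm], and every
    convergence statement is reduced to a bound by K / 2^n. *)

Set Implicit Arguments.
Unset Strict Implicit.
Unset Printing Implicit Defensive.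

Import Order.TTheory GRing.Theory Num.Theory.
Import numFieldNormedType.Exports.

Local Open Scope classical_set_scope.
Local Open Scope ring_scope.
Local Open Scope complex_scope.

(** * Real-valued norms and geometric convergence *)

HB.instance Definition _ (R : realType) (X Y : normedModType (Cplx R))
  (S : bop X Y) :=
  GRing.isLinear.Build (Cplx R) X Y _ (bop_val S) (bop_linear S).

Definition nrm (R : realType) (X : normedModType (Cplx R)) (x : X) : R :=
  complex.Re `|x|.

Section Norm.
Variables (R : realType) (X : normedModType (Cplx R)).
Implicit Types (x y : X) (a : Cplx R).

Lemma nrmE x : `|x| = (nrm x)%:C :> Cplx R.
Proof. exact/esym/ReK_ge0/normr_ge0. Qed.

Lemma nrm_ge0 x : 0 <= nrm x.
Proof. by rewrite -lecR -nrmE normr_ge0. Qed.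

Lemma nrm0 : nrm (0 : X) = 0.
Proof. by rewrite /nrm normr0. Qed.

Lemma nrm_eq0 x : nrm x <= 0 -> x = 0.
Proof. by move=> h; apply/eqP; rewrite -normr_le0 nrmE lecR. Qed.

Lemma nrmN x : nrm (- x) = nrm x.
Proof. by rewrite /nrm normrN. Qed.

Lemma nrmD x y : nrm (x + y) <= nrm x + nrm y.
Proof. by rewrite -lecR rmorphD /= -!nrmE ler_normD. Qed.

Lemma nrmB x y : nrm (x - y) <= nrm x + nrm y.
Proof. by rewrite -(nrmN y) nrmD. Qed.

Lemma nrm_dist x y : nrm (x - y) = nrm (y - x).
Proof. by rewrite -nrmN opprB. Qed.

Lemma nrm_triangle x y z : nrm (x - z) <= nrm (x - y) + nrm (y - z).
Proof. by rewrite -[x - z](subrKA y); exact: nrmD. Qed.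

Lemma nrmZ a x : nrm (a *: x) = nrm (a : (Cplx R)^o) * nrm x.
Proof.
apply: (@complexI R); rewrite -nrmE normrZ [RHS]rmorphM/=.
by rewrite -!nrmE.
Qed.

Lemma nrm_gt0 x : x != 0 -> 0 < nrm x.
Proof.
move=> x0; rewrite lt_def nrm_ge0 andbT; apply: contra_neq x0 => h.
by apply: nrm_eq0; rewrite h.
Qed.

Lemma nrm_bound_ge0 x (K r : R) : nrm x <= K * r ^+ 0 -> 0 <= K.
Proof. by rewrite expr0 mulr1; apply: le_trans; exact: nrm_ge0. Qed.

Lemma nrm_sum (I : Type) (r : seq I) (P : pred I) (F : I -> X) :
  nrm (\sum_(i <- r | P i) F i) <= \sum_(i <- r | P i) nrm (F i).
Proof.
elim/big_ind2: _ => //; first by rewrite nrm0.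
by move=> x1 x2 y1 y2 h1 h2; rewrite (le_trans (nrmD _ _))// lerD.
Qed.

End Norm.

Section ScalarNorm.
Variable R : realType.
Implicit Types a b : Cplx R.

Lemma nrmM a b :
  nrm (a * b : (Cplx R)^o) = nrm (a : (Cplx R)^o) * nrm (b : (Cplx R)^o).
Proof. exact: (@nrmZ _ ((Cplx R)^o) a b). Qed.

Lemma nrm1 : nrm (1 : (Cplx R)^o) = 1.
Proof. by rewrite /nrm normr1. Qed.

Lemma nrmX a n : nrm (a ^+ n : (Cplx R)^o) = nrm (a : (Cplx R)^o) ^+ n.
Proof. by elim: n => [|n IH]; rewrite ?expr0 ?nrm1// !exprS nrmM IH. Qed.

Lemma nrm_real (r : R) : nrm (r%:C : (Cplx R)^o) = `|r|.
Proof. by rewrite /nrm [`|_|]normc_def /= expr0n addr0 sqrtr_sqr. Qed.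

Lemma nrm_ReIm (z : Cplx R) :
  nrm (z : (Cplx R)^o) = Num.sqrt (complex.Re z ^+ 2 + complex.Im z ^+ 2).
Proof. by rewrite /nrm [`|_|]normc_def. Qed.

Lemma Re_le_nrm (z : Cplx R) : `|complex.Re z| <= nrm (z : (Cplx R)^o).
Proof. by rewrite nrm_ReIm -sqrtr_sqr ler_wsqrtr// lerDl sqr_ge0. Qed.

Lemma Im_le_nrm (z : Cplx R) : `|complex.Im z| <= nrm (z : (Cplx R)^o).
Proof. by rewrite nrm_ReIm -sqrtr_sqr ler_wsqrtr// lerDr sqr_ge0. Qed.

Lemma nrm_le_ReIm (z : Cplx R) :
  nrm (z : (Cplx R)^o) <= `|complex.Re z| + `|complex.Im z|.
Proof.
rewrite nrm_ReIm -[leRHS]ger0_norm ?addr_ge0// -(sqrtr_sqr (_ + _)).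
rewrite ler_wsqrtr// sqrrD.
rewrite !real_normK ?num_real// -addrA [_ *+ 2 + _]addrC addrA lerDl.
by rewrite mulrn_wge0 ?mulr_ge0.
Qed.

End ScalarNorm.

Lemma half_ge0 (R : realType) n : 0 <= (2^-1 : R) ^+ n.
Proof. by rewrite exprn_ge0// invr_ge0. Qed.

Lemma half_expn_lim (R : realType) (K x : R) :
  (forall n, x <= K * 2^-1 ^+ n) -> x <= 0.
Proof.
move=> h; rewrite leNgt; apply/negP => x0.
have K0 : 0 < K by have := h 0; rewrite expr0 mulr1; apply: lt_le_trans.
pose n := Num.trunc (K / x).
have hn : K / x < n.+1%:R by rewrite truncnS_gt.
have h2 : (n.+1%:R : R) <= 2 ^+ n.+1.
  by rewrite -natrX ler_nat ltnW// ltn_expl.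
have := h n.+1; rewrite leNgt => /negP; apply.
rewrite exprVn ltr_pdivrMr ?exprn_gt0//.
move: hn; rewrite ltr_pdivrMr// => /lt_le_trans; apply.
by rewrite mulrC ler_wpM2l// ltW.
Qed.

(** Completeness in the only form used below.  Unlike completeness of a
    uniform space it transfers at once to spaces of bounded operators, and the
    limit comes with its rate. *)
Definition geo_complete (R : realType) (X : normedModType (Cplx R)) : Prop :=
  forall (u : nat -> X) (K : R),
    (forall n, nrm (u n.+1 - u n) <= K * 2^-1 ^+ n) ->
  exists l, forall n, nrm (l - u n) <= 2 * K * 2^-1 ^+ n.

Section Geometric.
Variables (R : realType) (X : normedModType (Cplx R)) (u : nat -> X) (K : R).
Hypothesis hu : forall n, nrm (u n.+1 - u n) <= K * 2^-1 ^+ n.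

Lemma geo_dist p k : nrm (u (p + k)%N - u p) <= 2 * K * 2^-1 ^+ p.
Proof.
have K0 := nrm_bound_ge0 (hu 0%N).
have H : nrm (u (p + k)%N - u p) <= 2 * K * (1 - 2^-1 ^+ k) * 2^-1 ^+ p.
  elim: k => [|k IH]; first by rewrite addn0 subrr nrm0 expr0 subrr mulr0 mul0r.
  rewrite (le_trans (nrm_triangle _ (u (p + k)%N) _))// addnS.
  have := hu (p + k)%N; rewrite exprD exprS; move: IH; lra.
rewrite (le_trans H)// ler_wpM2r ?half_ge0// ler_piMr ?mulr_ge0//.
by rewrite gerBl half_ge0.
Qed.

(** The rate of convergence is forced by the steps: whatever limit exists, it
    satisfies the bound demanded by [geo_complete]. *)
Lemma geo_limit l :
  (forall e, 0 < e -> exists N, forall m, (N <= m)%N -> nrm (l - u m) <= e) ->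
  forall n, nrm (l - u n) <= 2 * K * 2^-1 ^+ n.
Proof.
move=> h n; apply/ler_addgt0Pr => e /h[N hN].
have := hN (n + N)%N (leq_addl _ _); have := geo_dist n N.
have := nrm_triangle l (u (n + N)%N) (u n); lra.
Qed.

End Geometric.

(** The lower envelopes u n - 2 K / 2^n have a supremum, and it is the limit. *)
Lemma real_geo_complete (R : realType) (u : nat -> R) (K : R) :
  (forall n, `|u n.+1 - u n| <= K * 2^-1 ^+ n) ->
  exists l, forall n, `|l - u n| <= 2 * K * 2^-1 ^+ n.
Proof.
move=> h; pose v n := u n - 2 * K * 2^-1 ^+ n.
have K0 : 0 <= K by have := h 0; rewrite expr0 mulr1; apply: le_trans.
have P i : 0 <= K * 2^-1 ^+ i by rewrite mulr_ge0// half_ge0.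
have H n k : `|u (n + k)%N - u n| <= 2 * K * 2^-1 ^+ n.
  have := @geo_dist R (Cplx R)^o (fun n => (u n)%:C) K.
  rewrite -nrm_real rmorphB; apply=> m.
  by have := h m; rewrite -nrm_real rmorphB.
have vw n m : v m <= u n + 2 * K * 2^-1 ^+ n.
  have := P n; have := P m; rewrite /v; case: (leqP m n) => [le|/ltnW le].
    have := H m (n - m)%N; rewrite subnKC// ler_norml; lra.
  have := H n (m - n)%N; rewrite subnKC// ler_norml; lra.
have hs : has_sup (range v).
  split; first by exists (v 0), 0.
  by exists (u 0 + 2 * K * 2^-1 ^+ 0) => _ [m _ <-]; exact: vw.
exists (sup (range v)) => n; rewrite ler_norml; apply/andP; split.
  have : v n <= sup (range v) by apply: ub_le_sup; [case: hs | exists n].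
  rewrite /v; lra.
rewrite lerBlDl; apply: ge_sup; first by case: hs.
by move=> _ [m _ <-]; exact: vw.
Qed.

Lemma half_expn_small (R : realType) (K e : R) : 0 < e ->
  exists N, forall m, (N <= m)%N -> K * 2^-1 ^+ m <= e.
Proof.
move=> e0; case: (lerP K 0) => K0.
  exists 0 => m _; rewrite (le_trans _ (ltW e0))// mulr_le0_ge0 ?half_ge0//.
have [N hN] : exists N, K * 2^-1 ^+ N <= e.
  apply: contrapT => /forallNP h.
  have := @half_expn_lim R K e; rewrite leNgt e0 => /(_ _)/negP; apply=> // n.
  by rewrite ltW// ltNge; apply/negP/h.
exists N => m Nm; rewrite (le_trans _ hN)// ler_wpM2l ?(ltW K0)//.
by apply: ler_wiXn2l => //; lra.
Qed.

Lemma Cplx_geo_complete (R : realType) : geo_complete (Cplx R)^o.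
Proof.
move=> u K h.
have ReB (x y : Cplx R) : complex.Re (x - y) = complex.Re x - complex.Re y.
  by case: x; case: y.
have ImB (x y : Cplx R) : complex.Im (x - y) = complex.Im x - complex.Im y.
  by case: x; case: y.
have [|a ha] := @real_geo_complete R (fun n => complex.Re (u n)) K.
  by move=> n; rewrite -ReB (le_trans (Re_le_nrm _)).
have [|b hb] := @real_geo_complete R (fun n => complex.Im (u n)) K.
  by move=> n; rewrite -ImB (le_trans (Im_le_nrm _)).
exists (a +i* b); apply: (geo_limit h) => // e e0.
have [N hN] := half_expn_small (4 * K) e0.
exists N => m /hN /(le_trans _); apply.
rewrite (le_trans (nrm_le_ReIm _))// ReB ImB /=.
by have := ha m; have := hb m; lra.
Qed.

Lemma nrm_lim_uniq (R : realType) (X : normedModType (Cplx R)) (x y : X)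
    (K : R) :
  (forall n, nrm (x - y) <= K * 2^-1 ^+ n) -> x = y.
Proof. by move=> /half_expn_lim /nrm_eq0 /eqP; rewrite subr_eq0 => /eqP. Qed.

Lemma Cplx_gt0 (R : realType) (e : Cplx R) :
  0 < e -> exists2 r : R, 0 < r & e = r%:C.
Proof.
move=> e0; exists (complex.Re e); last by rewrite ReK_ge0// ltW.
by rewrite -ltcR ReK_ge0// ltW.
Qed.

Lemma cvg_geo (R : realType) (X : normedModType (Cplx R)) (u : nat -> X) l
    (K : R) :
  (forall n, nrm (l - u n) <= K * 2^-1 ^+ n) -> u @ \oo --> l.
Proof.
move=> h; apply/cvgrPdist_le => e /Cplx_gt0[r r0 ->].
have [N hN] := half_expn_small K r0; exists N => // n /= /hN le.
by rewrite nrmE lecR (le_trans (h n)).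
Qed.

Lemma banach_geo_complete (R : realType) (X : completeNormedModType (Cplx R)) :
  geo_complete X.
Proof.
move=> u K h.
have : cauchy (u @ \oo).
  apply/cauchyP => e /Cplx_gt0[r r0 ->].
  have [N hN] := half_expn_small (2 * K) (divr_gt0 r0 (ltr0Sn R 1)).
  exists (u N); exists N => // n /= Nn.
  rewrite -ball_normE /ball_/= nrmE ltcR nrm_dist -(subnKC Nn).
  rewrite (le_lt_trans (geo_dist h _ _))// (le_lt_trans (hN _ _))//; lra.
move=> /cauchy_cvgP /cvg_ex[l /cvgrPdist_le ul]; exists l.
apply: (geo_limit h) => e e0.
have [|N _ hN] := ul e%:C; first by rewrite ltcR.
by exists N => m /hN /=; rewrite nrmE lecR.
Qed.

(** * The open mapping theorem *)

(** Baire category.  If no E k were dense in a ball, each closed ball would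
    contain a ball of at most half the radius missing E k; the centers of these
    nested balls converge to a point outside every E k. *)
Lemma baire_geo (R : realType) (X : normedModType (Cplx R)) (E : nat -> set X) :
  geo_complete X -> (forall x, exists k, E k x) ->
  exists k x r, 0 < r /\ forall y, nrm (y - x) <= r ->
    forall e, 0 < e -> exists2 z, E k z & nrm (z - y) <= e.
Proof.
move=> gX Ecover; apply: contrapT => nodense.
have next (t : nat * (X * R)) : exists s : X * R, 0 < t.2.2 ->
    [/\ nrm (s.1 - t.2.1) <= t.2.2 / 2, 0 < s.2, s.2 <= t.2.2 / 2
      & forall z, E t.1 z -> s.2 < nrm (z - s.1)].
  case: t => k [x r] /=.
  case: (pselect (0 < r)) => [r0|]; last by exists (x, r).
  apply: contrapT => /forallNP nos; apply: nodense.
  exists k, x, (r / 2); split; first by rewrite divr_gt0.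
  move=> y yx e e0; apply: contrapT => noz.
  apply: (nos (y, Num.min e (r / 2))) => _; split => //=.
  - by rewrite lt_min e0 divr_gt0.
  - by rewrite ge_min lexx orbT.
  - move=> z Ez; rewrite ltNge; apply/negP => zy; apply: noz; exists z => //.
    by rewrite (le_trans zy)// ge_min lexx.
have [f fP] := choice next.
pose s := fix s n := if n is n'.+1 then f (n', s n') else (0 : X, 1 : R).
have s_gt0 n : 0 < (s n).2.
  by elim: n => [|n IH] /=; rewrite ?ltr01//; case: (fP (n, s n) IH).
have sP n : [/\ nrm ((s n.+1).1 - (s n).1) <= (s n).2 / 2,
    (s n.+1).2 <= (s n).2 / 2 &
    forall z, E n z -> (s n.+1).2 < nrm (z - (s n.+1).1)].
  by case: (fP (n, s n) (s_gt0 n)).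
have s2 p n : (s (p + n)%N).2 <= (s p).2 * 2^-1 ^+ n.
  elim: n => [|n IH]; first by rewrite addn0 expr0 mulr1.
  by rewrite addnS exprS; case: (sP (p + n)%N) => _ + _; move: IH; lra.
have geo p n : nrm ((s (p + n.+1)%N).1 - (s (p + n)%N).1) <=
    (s p).2 / 2 * 2^-1 ^+ n.
  by rewrite addnS; case: (sP (p + n)%N) => + _ _; have := s2 p n; lra.
have [l lP] := gX (fun n => (s n).1) _ (geo 0%N).
have [k Ek] := Ecover l; have [_ _ /(_ l Ek)] := sP k.
rewrite ltNge => /negP; apply.
have := @geo_limit _ _ _ _ (geo k.+1) l _ 0%N.
rewrite addn0 expr0 mulr1 mulrC mulfVK ?pnatr_eq0//; apply => e e0.
have [N hN] := half_expn_small (2 * ((s 0%N).2 / 2)) e0; exists N => m Nm.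
by rewrite (le_trans (lP _))// hN// (leq_trans Nm)// leq_addl.
Qed.

(** The open mapping theorem, freed from the operator: E x t stands for the
    existence of a preimage of x of size at most t.  By Baire some level set of
    E is dense in a ball, so by differences and scaling every y is approximated
    arbitrarily well by some z with E z (C |y|); correcting the error again and
    again writes y as a series of such z with geometrically decreasing sizes.
    This form covers maps from a product of spaces without building a norm on
    the product. *)
Lemma open_mapping_gauge (R : realType) (X : normedModType (Cplx R))
    (E : X -> R -> Prop) :
  geo_complete X ->
  (forall x s t, s <= t -> E x s -> E x t) ->
  (forall x y s t, E x s -> E y t -> E (x + y) (s + t)) ->
  (forall a x t, E x t -> E (a *: x) (nrm (a : (Cplx R)^o) * t)) ->
  (forall (z : nat -> X) K y, (forall n, E (z n) (K * 2^-1 ^+ n)) ->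
     (forall n, nrm (y - \sum_(i < n) z i) <= K * 2^-1 ^+ n) -> E y (2 * K)) ->
  (forall x, exists t, E x t) ->
  exists2 C, 0 <= C & forall x, E x (C * nrm x).
Proof.
move=> gX Ele ED EZ Esum Etot.
have [|k [x0 [r [r0 dense]]]] :=
  @baire_geo R X (fun k => [set x | E x k%:R]) gX.
  move=> x; have [t xt] := Etot x; exists (Num.trunc t).+1 => /=.
  by apply: Ele xt; rewrite ltW// truncnS_gt.
have approx0 y e : nrm y <= r -> 0 < e ->
    exists2 z, E z (2 * k%:R) & nrm (y - z) <= e.
  move=> yr e0; have e2 : 0 < e / 2 by rewrite divr_gt0.
  have [|z1 Ez1 d1] := dense (x0 + y) _ _ e2; first by rewrite addrC addKr.
  have [|z2 Ez2 d2] := dense x0 _ _ e2; first by rewrite subrr nrm0 ltW.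
  exists (z1 - z2).
    rewrite mulr_natl mulr2n; apply: ED => //.
    by have := EZ (-1) _ _ Ez2; rewrite scaleN1r nrmN nrm1 mul1r.
  rewrite (_ : y - (z1 - z2) = (x0 + y - z1) + (z2 - x0)).
    rewrite (le_trans (nrmD _ _))// [nrm (_ - z1)]nrm_dist; lra.
  rewrite opprB [x0 + y]addrC -!addrA; congr (y + _).
  by rewrite addrCA [x0 + _]addrC subrK addrC.
pose C := 2 * k%:R / r; have C0 : 0 <= C by rewrite divr_ge0 ?mulr_ge0// ltW.
have approx y e : 0 < e -> exists z, E z (C * nrm y) /\ nrm (y - z) <= e.
  move=> e0; have [->|y0] := eqVneq y 0.
    have [t Et] := Etot 0; exists 0; split; last by rewrite subrr nrm0 ltW.
    by have := EZ 0 _ _ Et; rewrite scaler0 !nrm0 mul0r mulr0.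
  have ny := nrm_gt0 y0.
  pose c : R := r / nrm y; have c0 : 0 < c by rewrite divr_gt0.
  have [||z Ez dz] := approx0 (c%:C *: y) (e * c).
  - by rewrite nrmZ nrm_real gtr0_norm// mulfVK ?gt_eqF.
  - by rewrite mulr_gt0.
  have nc : nrm ((c^-1)%:C : (Cplx R)^o) = c^-1.
    by rewrite nrm_real gtr0_norm ?invr_gt0.
  exists ((c^-1)%:C *: z); split.
    have -> : C * nrm y = c^-1 * (2 * k%:R).
      by rewrite /C /c; field; rewrite !gt_eqF.
    by have := EZ (c^-1)%:C _ _ Ez; rewrite nc.
  have {1}<- : (c^-1)%:C *: (c%:C *: y) = y.
    by rewrite scalerA -rmorphM mulVf ?gt_eqF// rmorph1 scale1r.
  by rewrite -scalerBr nrmZ nc mulrC ler_pdivrMr.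
(* C + 1 bounds both the sizes of the terms and the remainders *)
exists (2 * (C + 1)) => [|y]; first by rewrite mulr_ge0// addr_ge0.
have [->|y0] := eqVneq y 0.
  have [t Et] := Etot 0.
  by have := EZ 0 _ _ Et; rewrite scaler0 !nrm0 mul0r mulr0.
have ny := nrm_gt0 y0.
have next (t : nat * X) : exists z,
    E z (C * nrm t.2) /\ nrm (t.2 - z) <= nrm y * 2^-1 ^+ t.1.+1.
  by apply: approx; rewrite mulr_gt0// exprn_gt0// invr_gt0.
have [f fP] := choice next.
pose s := fix s n := if n is n'.+1 then s n' - f (n', s n') else y.
have sE n : s n = y - \sum_(i < n) f (i : nat, s i).
  elim: n => [|n IH]; first by rewrite big_ord0 subr0.
  by rewrite big_ord_recr /= opprD addrA -IH.
have sn n : nrm (s n) <= nrm y * 2^-1 ^+ n.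
  by case: n => [|n] /=; [rewrite expr0 mulr1 | case: (fP (n, s n))].
rewrite -mulrA; apply: (Esum (fun n => f (n, s n))) => n.
  apply: Ele (fP (n, s n)).1 => /=; rewrite -[leRHS]mulrA.
  rewrite (le_trans (ler_wpM2l C0 (sn n)))// ler_wpM2r ?lerDl//.
  by rewrite mulr_ge0 ?half_ge0// ltW.
rewrite -sE (le_trans (sn n))// -[leRHS]mulrA ler_peMl ?lerDr//.
by rewrite mulr_ge0 ?half_ge0// ltW.
Qed.

Definition lincomb (K : fieldType) (V : lmodType K) n (e : 'I_n -> V)
  (c : 'rV[K]_n) : V := \sum_(i < n) c ord0 i *: e i.

Lemma lincomb_linear (K : fieldType) (V : lmodType K) n (e : 'I_n -> V) :
  linear (lincomb e).
Proof.
move=> a c d; rewrite /lincomb scaler_sumr -big_split /=; apply: eq_bigr => i _.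
by rewrite !mxE scalerDl scalerA.
Qed.

HB.instance Definition _ (K : fieldType) (V : lmodType K) n (e : 'I_n -> V) :=
  GRing.isLinear.Build K 'rV[K]_n V _ (lincomb e) (lincomb_linear e).

Lemma nrm_bop (R : realType) (X Y : normedModType (Cplx R)) (S : bop X Y) x :
  nrm (S x) <= nrm S * nrm x.
Proof. by rewrite -lecR [leRHS]rmorphM /= -!nrmE; exact: le_opnorm. Qed.

Lemma nrm_bop_le (R : realType) (X Y : normedModType (Cplx R)) (S : bop X Y)
    (M : R) :
  0 <= M -> (forall x, nrm (S x) <= M * nrm x) -> nrm S <= M.
Proof.
move=> M0 h; rewrite -lecR -nrmE; apply: opnorm_le; first by rewrite lecR.
by move=> x; rewrite !nrmE -rmorphM lecR.
Qed.

Lemma nrm_lincomb (R : realType) (X : normedModType (Cplx R)) m (e : 'I_m -> X)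
    (c : 'rV[Cplx R]_m) (t : R) :
  (forall i, nrm (c ord0 i : (Cplx R)^o) <= t) ->
  nrm (lincomb e c) <= t * \sum_i nrm (e i).
Proof.
move=> h; rewrite (le_trans (nrm_sum _ _ _))// mulr_sumr ler_sum// => i _.
by rewrite nrmZ ler_wpM2r ?nrm_ge0.
Qed.

(** The gauge is applied to the surjection (v, c) |-> P v + lincomb e c. *)
Lemma open_mapping_codim (R : realType) (X Y : normedModType (Cplx R))
    (P : bop X Y) m (e : 'I_m -> Y) :
  geo_complete X -> geo_complete Y ->
  (forall y, exists v c, y = P v + lincomb e c) ->
  exists2 C : R, 0 <= C & forall y, exists v c, [/\ y = P v + lincomb e c,
     nrm v <= C * nrm y & forall i, nrm (c ord0 i : (Cplx R)^o) <= C * nrm y].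
Proof.
move=> gX gY Psurj.
pose E y t := exists v c, [/\ y = P v + lincomb e c, nrm v <= t &
   forall i, nrm (c ord0 i : (Cplx R)^o) <= t].
apply: (@open_mapping_gauge R Y E gY).
- move=> x s t st [v [c [-> vs cs]]]; exists v, c.
  by split=> // [|i]; rewrite (le_trans _ st).
- move=> x y s t [v [c [-> vs cs]]] [w [d [-> wt dt]]]; exists (v + w), (c + d).
  split; first by rewrite !linearD addrACA.
    by rewrite (le_trans (nrmD _ _))// lerD.
  by move=> i; rewrite mxE (le_trans (nrmD _ _))// lerD.
- move=> a x t [v [c [-> vt ct]]]; exists (a *: v), (a *: c).
  split; first by rewrite scalerDr !linearZ.
    by rewrite nrmZ ler_wpM2l ?nrm_ge0.
  by move=> i; rewrite mxE nrmM ler_wpM2l ?nrm_ge0.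
- move=> z K y zE yz.
  have zE' n : exists p : X * 'rV[Cplx R]_m,
      [/\ z n = P p.1 + lincomb e p.2, nrm p.1 <= K * 2^-1 ^+ n &
       forall i, nrm (p.2 ord0 i : (Cplx R)^o) <= K * 2^-1 ^+ n].
    by have [v [c h]] := zE n; exists (v, c).
  have [vc vcP] := choice zE'.
  have K0 : 0 <= K by have [_ /nrm_bound_ge0 + _] := vcP 0%N.
  pose sv N := \sum_(n < N) (vc n).1; pose sc N := \sum_(n < N) (vc n).2.
  have [|v vP] := gX sv K.
    by move=> n; rewrite /sv big_ord_recr /= addrAC subrr add0r; case: (vcP n).
  have cex i : exists ci : Cplx R, forall n,
      nrm (ci - sc n ord0 i : (Cplx R)^o) <= 2 * K * 2^-1 ^+ n.
    apply: (@Cplx_geo_complete R (fun n => sc n ord0 i)) => n.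
    by rewrite /sc big_ord_recr /= mxE addrAC subrr add0r; case: (vcP n).
  have [c cP] := choice cex.
  pose c' : 'rV_m := \row_i c i.
  exists v, c'; split.
  + apply: (@nrm_lim_uniq _ _ _ _
      (K + (nrm P * (2 * K) + 2 * K * \sum_i nrm (e i)))).
    move=> n; rewrite (_ : y - _ = (y - \sum_(i < n) z i) -
        (P (v - sv n) + lincomb e (c' - sc n))).
      rewrite (le_trans (nrmB _ _))// [leRHS]mulrDl lerD//.
      rewrite (le_trans (nrmD _ _))// [leRHS]mulrDl lerD//.
        by rewrite (le_trans (nrm_bop _ _))// -mulrA ler_wpM2l ?nrm_ge0.
      rewrite mulrAC; apply: nrm_lincomb => i; rewrite 2!mxE.
      by rewrite /c' mxE.
    have -> : \sum_(i < n) z i = P (sv n) + lincomb e (sc n).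
      rewrite !linear_sum -big_split; apply: eq_bigr => i _ /=.
      by case: (vcP i).
    rewrite -[RHS]addrA -opprD; congr (y - _).
    by rewrite addrACA -!linearD /= [sv n + _]addrC subrK [sc n + _]addrC subrK.
  + by have := vP 0; rewrite /sv big_ord0 subr0 expr0 mulr1.
  + move=> i; have := cP i 0.
    by rewrite /sc big_ord0 mxE subr0 expr0 mulr1 /c' mxE.
- move=> y; have [v [c yE]] := Psurj y.
  exists (nrm v + \sum_i nrm (c ord0 i : (Cplx R)^o)), v, c; split => //.
    by rewrite lerDl sumr_ge0// => i _; exact: nrm_ge0.
  move=> i; rewrite (bigD1 i)//= addrCA lerDl addr_ge0 ?nrm_ge0//.
  by rewrite sumr_ge0// => j _; exact: nrm_ge0.
Qed.

(** * Vector-valued power series *)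

Section BinomialTails.
Variable R : realType.

(** The binomial coefficients vanish beyond n, so the sum may be lengthened
    until it has at least N terms. *)
Lemma exprDn_tail (A : comNzRingType) (x y : A) n N :
  (x + y) ^+ n = \sum_(0 <= k < N + n.+1) (x ^+ (n - k) * y ^+ k) *+ 'C(n, k).
Proof.
rewrite exprDn.
rewrite -(big_mkord xpredT (fun k => (x ^+ (n - k) * y ^+ k) *+ 'C(n, k))).
rewrite [RHS](@big_cat_nat _ _ _ n.+1)//= ?leq_addl//.
rewrite [X in _ + X]big_nat_cond.
rewrite [X in _ + X]big1 ?addr0// => k /andP[/andP[nk _] _].
by rewrite bin_small.
Qed.

Lemma nrmMn_le (X : normedModType (Cplx R)) (x : X) m :
  nrm (x *+ m) <= nrm x *+ m.
Proof.
elim: m => [|m IH]; first by rewrite !mulr0n nrm0.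
by rewrite !mulrS (le_trans (nrmD _ _))// lerD.
Qed.

Lemma binomial_term_le (w r : R) n k : 0 <= w -> 0 <= r ->
  (w ^+ (n - k) * r ^+ k) *+ 'C(n, k) <= (w + r) ^+ n.
Proof.
move=> w0 r0; rewrite (exprDn_tail _ _ n k.+1) big_mkord.
have hk : (k < k.+1 + n.+1)%N by rewrite addSn ltnS leq_addr.
rewrite (bigD1 (Ordinal hk))//= lerDl sumr_ge0// => i _.
by rewrite mulrn_wge0// mulr_ge0 ?exprn_ge0.
Qed.

(** Replacing |h| by 2 |h| multiplies the k-th term by 2^k, which is at least
    2^N for each of the omitted indices. *)
Lemma binomial_tail_le (w h : Cplx R) n N :
  nrm ((w + h) ^+ n -
       \sum_(k < N) (w ^+ (n - k) * h ^+ k) *+ 'C(n, k) : (Cplx R)^o)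
    <= 2^-1 ^+ N * (nrm (w : (Cplx R)^o) + 2 * nrm (h : (Cplx R)^o)) ^+ n.
Proof.
set nw := nrm (w : (Cplx R)^o); set nh := nrm (h : (Cplx R)^o).
have w0 : 0 <= nw by exact: nrm_ge0.
have h0 : 0 <= nh by exact: nrm_ge0.
rewrite (exprDn_tail _ _ _ N) (@big_cat_nat _ _ _ N)//= ?leq_addr//.
rewrite big_mkord addrAC subrr add0r (le_trans (nrm_sum _ _ _))//.
rewrite (exprDn_tail _ _ _ N) mulr_sumr.
rewrite [leRHS](@big_cat_nat _ _ _ N)//= ?leq_addr//.
rewrite -[leLHS]add0r lerD//.
  rewrite sumr_ge0// => i _; rewrite mulr_ge0 ?half_ge0// mulrn_wge0//.
  by rewrite mulr_ge0 ?exprn_ge0 ?mulr_ge0.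
rewrite big_nat_cond [leRHS]big_nat_cond ler_sum// => k /andP[/andP[Nk _] _].
rewrite (le_trans (nrmMn_le _ _))// mulrnAr lerMn2r; apply/orP; right.
rewrite nrmM !nrmX exprMn mulrCA ler_wpM2l ?exprn_ge0//.
rewrite mulrA ler_peMl ?exprn_ge0// exprVn mulrC ler_pdivlMr ?exprn_gt0// mul1r.
by rewrite ler_eXn2l ?ltr1n.
Qed.

End BinomialTails.

Section PowerSeries.
Variables (R : realType) (Y : normedModType (Cplx R)) (gY : geo_complete Y).
Variables (x : nat -> Y) (K rho : R).
Hypothesis rho0 : 0 < rho.
Hypothesis xK : forall n, nrm (x n) <= K * rho ^+ n.

Let K0 : 0 <= K.
Proof. exact: nrm_bound_ge0 (xK 0%N). Qed.

Definition psum (z : Cplx R) N : Y := \sum_(n < N) z ^+ n *: x n.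

Lemma half_expnM (t : R) n : 0 <= t -> t * rho <= 2^-1 ->
  t ^+ n * (K * rho ^+ n) <= K * 2^-1 ^+ n.
Proof.
move=> t0 trho; rewrite mulrCA -exprMn ler_wpM2l// lerXn2r ?nnegrE ?invr_ge0//.
  by rewrite mulr_ge0// ltW.
Qed.

Lemma psum_limit : exists F : Cplx R -> Y, forall z,
  nrm (z : (Cplx R)^o) * rho <= 2^-1 ->
  forall N, nrm (F z - psum z N) <= 2 * K * 2^-1 ^+ N.
Proof.
have h (z : Cplx R) : exists l : Y, nrm (z : (Cplx R)^o) * rho <= 2^-1 ->
    forall N, nrm (l - psum z N) <= 2 * K * 2^-1 ^+ N.
  case: (lerP (nrm (z : (Cplx R)^o) * rho) 2^-1) => zrho; last by exists 0.
  have [n|l lP] := gY (u := psum z) (K := K); last by exists l.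
  rewrite /psum big_ord_recr /= addrAC subrr add0r nrmZ nrmX.
  rewrite (le_trans (ler_wpM2l _ (xK n))) ?exprn_ge0 ?nrm_ge0//.
  by rewrite half_expnM ?nrm_ge0.
by have [F FP] := choice h; exists F.
Qed.

(** The sum of a power series is analytic off the center too: at w the new
    coefficients are the sums over n of C(n, k) w^(n-k) x_n, and
    [binomial_tail_le] bounds the remainder after N terms uniformly in the
    truncation L of the original series. *)
Lemma psum_reexpand (F : Cplx R -> Y) (w : Cplx R) :
  (forall z, nrm (z : (Cplx R)^o) * rho <= 2^-1 ->
     forall N, nrm (F z - psum z N) <= 2 * K * 2^-1 ^+ N) ->
  nrm (w : (Cplx R)^o) * rho <= 4^-1 ->
  exists y : nat -> Y, forall h : Cplx R, nrm (h : (Cplx R)^o) * rho <= 8^-1 ->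
    forall N, nrm (F (w + h) - \sum_(k < N) h ^+ k *: y k) <= 2 * K * 2^-1 ^+ N.
Proof.
move=> FP wrho; set nw := nrm _ in wrho; have nw0 : 0 <= nw by exact: nrm_ge0.
(* C(n, k) |w|^(n-k) r^k <= (|w| + r)^n <= (2 rho)^-n, for this radius r *)
pose r := (4 * rho)^-1; have r0 : 0 < r by rewrite invr_gt0 mulr_gt0.
have rrho : r * rho = 4^-1 by rewrite /r invfM mulfVK ?gt_eqF.
pose yp k L := \sum_(n < L) (w ^+ (n - k) *+ 'C(n, k)) *: x n.
have yex k : exists yk : Y, forall L,
    nrm (yk - yp k L) <= 2 * (K * r ^- k) * 2^-1 ^+ L.
  apply: gY => n; rewrite /yp big_ord_recr /= addrAC subrr add0r nrmZ.
  rewrite (le_trans (ler_wpM2l (nrm_ge0 _) (xK n)))//.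
  have b := @binomial_term_le R nw r n k nw0 (ltW r0).
  have : nrm (w ^+ (n - k) *+ 'C(n, k) : (Cplx R)^o) * r ^+ k <=
      (nw + r) ^+ n.
    rewrite (le_trans _ b)// -mulrnAl ler_wpM2r ?exprn_ge0 ?(ltW r0)//.
    by rewrite (le_trans (nrmMn_le _ _))// nrmX.
  rewrite -ler_pdivlMr ?exprn_gt0// => b'.
  rewrite (le_trans (ler_wpM2r _ b')) ?mulr_ge0 ?exprn_ge0 ?(ltW rho0)//.
  rewrite mulrAC [K * _ * 2^-1 ^+ n]mulrAC ler_wpM2r//.
    by rewrite invr_ge0 exprn_ge0 ?(ltW r0).
  by rewrite half_expnM ?addr_ge0 ?(ltW r0)// mulrDl rrho; lra.
have [y yP] := choice yex; exists y => h hrho N.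
set nh := nrm _ in hrho; have nh0 : 0 <= nh by exact: nrm_ge0.
apply/ler_addgt0Pr => e e0.
pose M := 2 * K + \sum_(k < N) nh ^+ k * (2 * (K * r ^- k)).
have [L /(_ L (leqnn L)) hL] := half_expn_small M e0.
have d1 : nrm (F (w + h) - psum (w + h) L) <= 2 * K * 2^-1 ^+ L.
  apply: FP; rewrite (le_trans (ler_wpM2r (ltW rho0) (nrmD _ _)))// mulrDl.
  by move: wrho hrho; rewrite /nw /nh; lra.
have d2 : nrm (\sum_(k < N) h ^+ k *: (y k - yp k L)) <=
    (\sum_(k < N) nh ^+ k * (2 * (K * r ^- k))) * 2^-1 ^+ L.
  rewrite (le_trans (nrm_sum _ _ _))// mulr_suml ler_sum// => k _.
  by rewrite nrmZ nrmX -mulrA ler_wpM2l ?exprn_ge0.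
have d3 : nrm (psum (w + h) L - \sum_(k < N) h ^+ k *: yp k L) <=
    2 * K * 2^-1 ^+ N.
  have -> : psum (w + h) L - \sum_(k < N) h ^+ k *: yp k L =
     \sum_(n < L) ((w + h) ^+ n -
        \sum_(k < N) (w ^+ (n - k) * h ^+ k) *+ 'C(n, k)) *: x n.
    under [RHS]eq_bigr do rewrite scalerBl scaler_suml.
    rewrite [RHS]sumrB exchange_big /=; congr (_ - _); apply: eq_bigr => k _.
    rewrite scaler_sumr; apply: eq_bigr => n _.
    by rewrite scalerA mulrnAr mulrC.
  rewrite (le_trans (nrm_sum _ _ _))//.
  have -> : 2 * K * 2^-1 ^+ N = 2^-1 ^+ N * (2 * K) by rewrite mulrC.
  apply: (@le_trans _ _ (\sum_(n < L) 2^-1 ^+ N * (K * 2^-1 ^+ n))).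
    rewrite ler_sum// => n _; rewrite nrmZ.
    rewrite (le_trans (ler_wpM2r (nrm_ge0 _) (binomial_tail_le _ _ _ _)))//.
    rewrite -mulrA ler_wpM2l ?half_ge0//.
    rewrite (le_trans (ler_wpM2l _ (xK n))) ?exprn_ge0 ?addr_ge0 ?mulr_ge0//.
    rewrite half_expnM ?addr_ge0 ?mulr_ge0// mulrDl -mulrA.
    by move: wrho hrho; rewrite /nw /nh; lra.
  rewrite -mulr_sumr ler_wpM2l ?half_ge0// -mulr_sumr mulrC ler_wpM2r//.
  have -> : \sum_(i < L) 2^-1 ^+ i = 2 * (1 - 2^-1 ^+ L) :> R.
    elim: L {hL d1 d2} => [|L IH]; first by rewrite big_ord0 expr0 subrr mulr0.
    by rewrite big_ord_recr /= IH exprS; lra.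
  by have := half_ge0 R L; lra.
set A := F (w + h) - psum (w + h) L in d1.
set B := psum (w + h) L - _ in d3; set D := \sum_(k < N) _ in d2.
have -> : F (w + h) - \sum_(k < N) h ^+ k *: y k = A + (B - D); last first.
  have t1 := nrmD A (B - D); have t2 := nrmB B D.
  by move: hL; rewrite /M mulrDl; lra.
rewrite /A /B /D !addrA subrK -addrA -opprD -big_split /=; congr (_ - _).
by apply: eq_bigr => k _; rewrite -scalerDr addrC subrK.
Qed.

End PowerSeries.

(** * Subspaces of a finite-dimensional space *)

Definition subsp (K : fieldType) (V : lmodType K) (W : set V) : Prop :=
  W 0 /\ forall a x y, W x -> W y -> W (a *: x + y).

Lemma subsp_sum (K : fieldType) (V : lmodType K) (W : set V) (I : Type)
    (r : seq I) (c : I -> K) (F : I -> V) :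
  subsp W -> (forall i, W (F i)) -> W (\sum_(i <- r) c i *: F i).
Proof.
move=> [W0 WD] WF; elim: r => [|i r IH]; first by rewrite big_nil.
by rewrite big_cons; apply: WD.
Qed.

(** A matrix of maximal rank among those with row space inside W: a vector of W
    outside its row space could be added to raise the rank. *)
Lemma subsp_mx (K : fieldType) k (W : set 'rV[K]_k) :
  subsp W -> exists A : 'M[K]_k, forall c, W c <-> (c <= A)%MS.
Proof.
move=> sW.
pose P r := `[< exists A : 'M[K]_k,
  (forall c, (c <= A)%MS -> W c) /\ \rank A = r >].
have exP : exists r, P r.
  exists 0%N; apply/asboolP; exists 0; rewrite mxrank0; split=> // c.
  by rewrite submx0 => /eqP->; case: sW.
have ubP r : P r -> (r <= k)%N.
  by move=> /asboolP[A [_ <-]]; exact: rank_leq_col.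
case: (ex_maxnP exP ubP) => _ /asboolP[A [AW <-]] maxA; exists A => c.
split=> [Wc|/AW//].
suff : (A + c <= A)%MS by apply: submx_trans; exact: addsmxSr.
rewrite -(geq_leqif (mxrank_leqif_sup (addsmxSl A c))).
apply: maxA; apply/asboolP.
exists (A + c)%MS; split=> // d /sub_addsmxP[[u v] /= ->].
rewrite [v *m c](_ : _ = v ord0 ord0 *: c).
  by rewrite addrC; apply: (sW.2) => //; apply: AW; exact: submxMl.
by rewrite [v]mx11_scalar mul_scalar_mx !mxE eqxx mulr1n.
Qed.

(** Choose the index where the rank of the coordinate space is least. *)
Lemma subsp_chain_stabilizes (K : fieldType) (V : lmodType K) k (e : 'I_k -> V)
    (W : nat -> set V) :
  (forall n, subsp (W n)) -> (forall n, W n.+1 `<=` W n) ->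
  (forall x, W 0%N x -> exists c, x = lincomb e c) ->
  exists n, forall m, (n <= m)%N -> W n `<=` W m.
Proof.
move=> sW decr We.
have sW' n : subsp (lincomb e @^-1` W n).
  have [W0 WD] := sW n; split; first by rewrite /preimage/= linear0.
  by move=> a c d Wc Wd; rewrite /preimage/= linearP; exact: WD.
have [A AP] := choice (fun n => subsp_mx (sW' n)).
have decr' n m : (n <= m)%N -> W m `<=` W n.
  move=> /subnKC <-; elim: (m - n)%N => [|d IH]; first by rewrite addn0.
  by rewrite addnS; exact: subset_trans (decr _) IH.
have AS n m : (n <= m)%N -> (A m <= A n)%MS.
  move=> nm; apply/row_subP => i; apply/(AP n)/(decr' _ _ nm)/(AP m).
  exact: row_sub.
have exr : exists r, (fun r => `[< exists n, \rank (A n) = r >]) r.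
  by exists (\rank (A 0)); apply/asboolP; exists 0%N.
case: (ex_minnP exr) => _ /asboolP[n <-] minr; exists n => m nm x Wx.
have [c xE] := We x (decr' _ _ (leq0n n) _ Wx); subst x.
have /(AP m) : (c <= A m)%MS; last by [].
have h : (A n <= A m)%MS.
  rewrite -(geq_leqif (mxrank_leqif_sup (AS _ _ nm))).
  by apply: minr; apply/asboolP; exists m.
by apply: submx_trans h; apply/(AP n).
Qed.

(** * The single-valued extension property and backward chains *)

(** What the extension property of T at l says of S = T - l once analytic
    functions are forgotten.  In this form it applies alike to an operator and
    to its dual. *)
Definition no_chain (R : realType) (Y : normedModType (Cplx R)) (S : bop Y Y) :=
  forall (x : nat -> Y) (K rho : R), 0 < rho ->
    (forall n, nrm (x n) <= K * rho ^+ n) ->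
    S (x 0%N) = 0 -> (forall n, S (x n.+1) = x n) -> x 0%N = 0.

Section SVEPChain.
Variables (R : realType) (Y : normedModType (Cplx R)) (gY : geo_complete Y).
Variables (T : bop Y Y) (l : Cplx R).

Lemma shiftE m (x : Y) : shift T m x = T x - m *: x.
Proof. by []. Qed.

Lemma bop_chain_psum (S : bop Y Y) (x : nat -> Y) (z : Cplx R) n :
  S (x 0%N) = 0 -> (forall n, S (x n.+1) = x n) ->
  S (psum x z n.+1) = z *: psum x z n.
Proof.
move=> S0 SS; rewrite /psum linear_sum big_ord_recl /=.
rewrite linearZ /= S0 scaler0 add0r scaler_sumr; apply: eq_bigr => i _.
by rewrite linearZ /= SS exprS scalerA.
Qed.

(** A chain of growth rho^n gives f(m) = sum of the (m - l)^n x_n, analytic on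
    |m - l| < 1 / (4 rho).  Since S shifts the chain, (S - (m - l)) f(m) = 0,
    and f(l) = x_0. *)
Lemma SVEP_no_chain : SVEP_at T l -> no_chain (shift T l).
Proof.
move=> svep x K rho rho0 xK S0 SS.
have [F FP] := psum_limit gY rho0 xK.
have K0 := nrm_bound_ge0 (xK 0%N).
have half_step n : 2 * K * 2^-1 ^+ n.+1 <= 2 * K * 2^-1 ^+ n.
  by rewrite ler_wpM2l ?mulr_ge0// exprS ler_piMl ?half_ge0//; lra.
pose U : set (Cplx R) := [set m | nrm (m - l : (Cplx R)^o) * rho < 4^-1].
have UE : U = ball l (4 * rho)^-1%:C.
  apply/funext => m; apply/propext; rewrite -ball_normE /ball_ /U /=.
  rewrite distrC [X in _ <-> is_true (X < _)](@nrmE R (Cplx R)^o (m - l)) ltcR.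
  by rewrite invfM ltr_pdivlMr.
have oU : open U by rewrite UE; exact: ball_open.
have Ul : U l by rewrite /U /= subrr nrm0 mul0r invr_gt0.
have h4 m : U m -> nrm (m - l : (Cplx R)^o) * rho <= 2^-1.
  by rewrite /U /=; lra.
suff : F (l - l) = 0.
  rewrite subrr => F0; apply: (@nrm_lim_uniq _ _ _ _ (2 * K)) => n.
  have := FP 0 _ n.+1; rewrite nrm0 mul0r F0 sub0r nrmN /psum big_ord_recl.
  rewrite big1 ?addr0 ?subr0 ?expr0 ?scale1r.
    by move=> h; apply: le_trans (half_step n); apply: h; rewrite invr_ge0.
  by move=> i _; rewrite /bump /= exprS mul0r scale0r.
apply: (svep U oU Ul (fun m => F (m - l))) => //.
- move=> m Um.
  have [|y yP] := psum_reexpand gY rho0 xK (w := m - l) FP; first exact: ltW.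
  exists y; apply/nbhs_ballP; exists (8 * rho)^-1%:C => /=.
    by rewrite ltcR invr_gt0 mulr_gt0.
  move=> m'; rewrite -ball_normE /ball_ /= distrC.
  rewrite (@nrmE R (Cplx R)^o (m' - m)) ltcR invfM ltr_pdivlMr// => /ltW mm'.
  apply: (@cvg_geo _ _ _ _ (2 * K)) => n.
  have := yP (m' - m) mm' n.
  by rewrite [m - l + _]addrC addrA subrK /series /= big_mkord.
- move=> m Um; apply: (@nrm_lim_uniq _ _ _ _
    (nrm (shift T l) * (2 * K) + nrm (m - l : (Cplx R)^o) * (2 * K))) => n.
  rewrite subr0; set z := m - l.
  have Spsum : shift T l (psum x z n.+1) = z *: psum x z n.
    exact: bop_chain_psum.
  have -> : shift T m (F z) =
      shift T l (F z - psum x z n.+1) - z *: (F z - psum x z n).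
    have -> : shift T l (F z - psum x z n.+1) =
        shift T l (F z) - shift T l (psum x z n.+1).
      exact: linearB.
    rewrite Spsum scalerBr opprB addrA subrK !shiftE -addrA -opprD.
    by rewrite -scalerDl [l + z]addrC /z subrK.
  rewrite (le_trans (nrmB _ _))// mulrDl lerD//.
    rewrite (le_trans (nrm_bop _ _))// -mulrA ler_wpM2l ?nrm_ge0//.
    by rewrite (le_trans (FP _ _ _))//; exact: h4.
  by rewrite nrmZ -mulrA ler_wpM2l ?nrm_ge0// FP// h4.
Qed.

End SVEPChain.

(** * Iterates and finite ascent *)

Section IteratedOperator.
Variables (R : realType) (X : normedModType (Cplx R)) (S : bop X X).

Lemma bounded_linear_iter n : bounded_linear (iter n S).
Proof.
elim: n => [|n IH]; first exact: bounded_linear_id.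
exact: (bounded_linear_comp S (Bop (mem_bop IH))).
Qed.

Definition iterb n : bop X X := Bop (mem_bop (bounded_linear_iter n)).

Lemma iter_null_space p n :
  null_space (iter p S) `<=` null_space (iter (p + n) S).
Proof.
move=> x; rewrite /null_space /= addnC iterD => ->.
exact: (linear0 (iterb n)).
Qed.

Lemma iter_range p n : range (iter (p + n) S) `<=` range (iter p S).
Proof. by move=> _ [x _ <-]; rewrite iterD; exists (iter n S x). Qed.

Lemma iter_0 n : iter n S 0 = 0.
Proof. exact: (linear0 (iterb n)). Qed.

Lemma iter_sub n x y : iter n S (x - y) = iter n S x - iter n S y.
Proof. exact: (linearB (iterb n)). Qed.

Lemma iter_add n x y : iter n S (x + y) = iter n S x + iter n S y.
Proof. exact: (linearD (iterb n)). Qed.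

End IteratedOperator.

Lemma subsp_null_space (R : realType) (X : normedModType (Cplx R))
    (S : bop X X) :
  subsp (null_space S).
Proof.
split; first exact: linear0.
by move=> a x y Nx Ny; rewrite /null_space /= linearP /= Nx Ny scaler0 addr0.
Qed.

Lemma subsp_range (R : realType) (X : normedModType (Cplx R)) (S : bop X X) :
  subsp (range S).
Proof.
split; first by exists 0 => //; exact: linear0.
by move=> a _ _ [x _ <-] [y _ <-]; exists (a *: x + y) => //; rewrite linearP.
Qed.

Definition bounded_lift (R : realType) (X Y : normedModType (Cplx R))
    (f : X -> Y) :=
  exists2 C : R, 0 <= C &
    forall x, exists2 v, f v = f x & nrm v <= C * nrm (f x).

(** Past the index n where N(S) /\ R(S^n) stabilizes, two preimages under S of
    a vector of all ranges that both lie in R(S^n) differ by an element of every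
    range.  So the bounded lift through S^(n+1) produces preimages that stay in
    all ranges, with a fixed growth factor, and no nonzero vector can start the
    resulting chain. *)
Lemma no_chain_ascent (R : realType) (Y : normedModType (Cplx R)) (S : bop Y Y)
    k (e : 'I_k -> Y) :
  no_chain S -> (forall x, S x = 0 -> exists c, x = lincomb e c) ->
  (forall n, bounded_lift (iter n S)) ->
  exists n, null_space (iter n S) = null_space (iter n.+1 S).
Proof.
move=> nochain Ne lift.
pose W n := null_space S `&` range (iter n S).
have [n Wn] : exists n, forall m, (n <= m)%N -> W n `<=` W m.
  apply: (@subsp_chain_stabilizes _ _ k e) => [n|n|x [/Ne]//].
    have [N0 ND] := subsp_null_space S; have [R0 RD] := subsp_range (iterb S n).
    split; first by split.
    by move=> a x y [Nx Rx] [Ny Ry]; split; [exact: ND|exact: RD].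
  move=> x [Nx Rx]; split=> //.
  by apply: (@iter_range _ _ S n 1); rewrite addn1.
exists n; apply/seteqP; split.
  by have := @iter_null_space _ _ S n 1; rewrite addn1.
move=> z Snz; have Wz : W n (iter n S z) by split => //; exists z.
pose M : set Y := [set y | forall m, range (iter m S) y].
have Mle y m : (forall m', (m <= m')%N -> range (iter m' S) y) -> M y.
  by move=> h m'; apply: (@iter_range _ _ S m' m); apply: h; exact: leq_addl.
have [C C0 liftC] := lift n.+1.
(* adding 1 keeps the growth factor positive *)
pose rho := nrm (iterb S n) * C + 1.
have rho0 : 0 < rho by rewrite ltr_wpDl// mulr_ge0 ?nrm_ge0.
have step y : exists x, M y -> [/\ M x, S x = y & nrm x <= rho * nrm y].
  case: (pselect (M y)) => [My|]; last by exists 0.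
  have [w _ wy] := My n.+1; have [v] := liftC w; rewrite wy => vy vC.
  exists (iter n S v) => _; split=> //.
    apply: (Mle _ n) => m nm; have [w' _ w'y] := My m.+1.
    have [|_ [u _ uE]] := Wn m nm (iter n S v - iter m S w').
      split.
        rewrite /null_space /= linearB /=.
        by move: vy w'y => /= -> ->; rewrite subrr.
      exists (v - iter (m - n) S w') => //.
      by rewrite iter_sub -iterD subnKC.
    exists (u + w') => //.
    by rewrite iter_add uE subrK.
  rewrite (le_trans (nrm_bop (iterb S n) v))// /rho mulrDl mul1r -mulrA.
  by rewrite (le_trans (ler_wpM2l (nrm_ge0 _) vC))// lerDl nrm_ge0.
have [g gP] := choice step.
pose x m := iter m g (iter n S z).
have xM m : M (x m).
  elim: m => [|m IH]; last by case: (gP (x m) IH).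
  by apply: (Mle _ n) => m nm; case: (Wn m nm _ Wz).
apply: (nochain x (nrm (x 0%N)) rho rho0).
- elim=> [|m IH]; first by rewrite expr0 mulr1.
  have [_ _ h] := gP (x m) (xM m).
  by rewrite (le_trans h)// exprS mulrCA ler_wpM2l// ltW.
- by [].
- by move=> m; case: (gP (x m) (xM m)).
Qed.

(** * Operators with finite-codimensional range, and their duals *)

(** The coordinates of X modulo R(P) are linear by uniqueness and bounded by the
    open mapping theorem: they are the bounded functionals that Hahn-Banach
    would otherwise have to supply. *)
Lemma codim_coordinates (R : realType) (X : normedModType (Cplx R))
    (P : bop X X) m :
  geo_complete X -> has_codim (range P) m ->
  exists (e : 'I_m -> X) (phi : 'I_m -> dual X) (C : R),
    [/\ 0 <= C, forall i x, phi i (P x) = 0 &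
      forall y, exists2 v,
        y = P v + \sum_i phi i y *: e i & nrm v <= C * nrm y].
Proof.
move=> gX [e eP].
have [g gP] := choice eP.
have gE v c : g (P v + lincomb e c) = c.
  by case: (gP (P v + lincomb e c)) => _ /(_ c); apply; rewrite addrK; exists v.
have gex y : exists v, y = P v + lincomb e (g y).
  by case: (gP y) => -[v _ vE] _; exists v; rewrite vE subrK.
have glin : linear g.
  move=> a x y; have [v xE] := gex x; have [w yE] := gex y.
  by rewrite {1}xE {1}yE scalerDr addrACA -!linearP; exact: gE.
have [|C C0 CP] := open_mapping_codim gX gX (P := P) (e := e).
  by move=> y; have [v vE] := gex y; exists v, (g y).
have philin i : bounded_linear (fun y => g y ord0 i : Cplx R).
  split; first by move=> a x y; rewrite glin !mxE.
  exists C%:C => y; have [v [c [yE _ cC]]] := CP y.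
  by rewrite {1}yE gE; move: (cC i); rewrite -lecR rmorphM /= -!nrmE.
exists e, (fun i => Bop (mem_bop (philin i))), C; split=> //.
  by move=> i x /=; have := gE x 0; rewrite linear0 addr0 => ->; rewrite mxE.
move=> y; have [v [c [yE vC _]]] := CP y; exists v => //=.
by rewrite yE gE.
Qed.

Lemma codim_bounded_lift (R : realType) (X : normedModType (Cplx R))
    (P : bop X X) m :
  geo_complete X -> has_codim (range P) m -> bounded_lift P.
Proof.
move=> gX /(codim_coordinates gX)[e [phi [C [C0 phiP lift]]]].
exists C => // x; have [v vE vC] := lift (P x); exists v => //.
rewrite [RHS]vE big1 ?addr0// => i _.
by rewrite phiP scale0r.
Qed.

(** The failure of a limit to be linear, expressed by approximation errors. *)
Lemma linear_defect (K : fieldType) (V : lmodType K) (a : K)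
    (p q r q' r' : V) :
  p - (a *: q + r) = (p - (a *: q' + r')) - (a *: (q - q') + (r - r')).
Proof. by rewrite scalerBr addrACA -opprD opprB addrA subrK. Qed.

Lemma bop_geo_complete (R : realType) (X Z : normedModType (Cplx R)) :
  geo_complete Z -> geo_complete (bop X Z).
Proof.
move=> gZ u K h.
have K0 := nrm_bound_ge0 (h 0%N).
have ex x : exists y : Z, forall n,
    nrm (y - u n x) <= 2 * (K * nrm x) * 2^-1 ^+ n.
  apply: (gZ (fun n => u n x)) => n.
  rewrite (le_trans (nrm_bop (u n.+1 - u n) x))// mulrAC.
  by rewrite ler_wpM2r ?nrm_ge0.
have [f fP] := choice ex.
have flin : linear f.
  move=> a x y; apply: (@nrm_lim_uniq R Z _ _
     (2 * (K * nrm (a *: x + y)) +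
      (nrm (a : (Cplx R)^o) * (2 * (K * nrm x)) + 2 * (K * nrm y)))) => n.
  rewrite (@linear_defect _ _ a _ (f x) (f y) (u n x) (u n y)).
  rewrite -(linearP (u n)) (le_trans (nrmB _ _))// mulrDl lerD ?fP//.
  rewrite (le_trans (nrmD _ _))// mulrDl lerD ?fP//.
  by rewrite nrmZ -mulrA ler_wpM2l ?nrm_ge0.
have fb x : nrm (f x) <= (nrm (u 0%N) + 2 * K) * nrm x.
  rewrite -[f x](subrK (u 0%N x)) (le_trans (nrmD _ _))// mulrDl addrC lerD//.
    exact: nrm_bop.
  by have := fP x 0%N; rewrite expr0 mulr1 mulrA.
have fbl : bounded_linear f.
  split=> //; exists (nrm (u 0%N) + 2 * K)%:C => x.
  by have := fb x; rewrite -lecR [X in _ <= X -> _]rmorphM /= -!nrmE.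
exists (Bop (mem_bop fbl)) => n; apply: nrm_bop_le => [|x].
  by rewrite !mulr_ge0// half_ge0.
by rewrite mulrAC -[2 * K * _]mulrA; exact: fP.
Qed.

Lemma bop_sumE (R : realType) (X Z : normedModType (Cplx R)) (I : Type)
    (r : seq I) (F : I -> bop X Z) x :
  (\sum_(i <- r) F i) x = \sum_(i <- r) F i x.
Proof.
exact: (big_morph (fun g : bop X Z => g x) (fun f g => bopD f g x)).
Qed.

Section Dual.
Variables (R : realType) (X : normedModType (Cplx R)) (S : bop X X).

Lemma iter_dual n (f : dual X) x :
  (iter n (dual_op S) f : dual X) x = f (iter n S x).
Proof. by elim: n f x => [//|n IH] f x; rewrite iterSr IH. Qed.

Lemma dual_shift (T : bop X X) l :
  shift (dual_op T) l = dual_op (shift T l).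
Proof.
apply: bopP => f; apply: bopP => x; apply/esym.
by rewrite -[LHS]/(f (T x - l *: x)) linearB /= bopZr.
Qed.

Lemma dual_geo_complete : geo_complete (dual X).
Proof. exact/bop_geo_complete/Cplx_geo_complete. Qed.

(** A functional that kills R(S) is determined by its values on the complement:
    f is the sum of the f(e_i) phi_i. *)
Lemma dual_null_span m : geo_complete X -> has_codim (range S) m ->
  exists phi : 'I_m -> dual X,
    forall f : dual X, dual_op S f = 0 -> exists c, f = lincomb phi c.
Proof.
move=> gX /(codim_coordinates gX)[e [phi [C [_ phiP lift]]]].
exists phi => f fS; exists (\row_i f (e i)); apply: bopP => x.
have fSx v : f (S v) = 0 := congr1 (fun g : dual X => g v) fS.
have [v vE _] := lift x.
rewrite bop_sumE {1}vE linearD /= fSx add0r linear_sum; apply: eq_bigr => i _.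
rewrite mxE; apply: etrans (bopZr f _ _) _; exact: mulrC.
Qed.

(** Subtracting the f(e_i) phi_i from f does not change f on R(S^n) and makes
    it vanish on the complement; what remains is f S^n composed with the bounded
    lift of S^n. *)
Lemma dual_bounded_lift m n :
  geo_complete X -> has_codim (range (iter n S)) m ->
  bounded_lift (iter n (dual_op S)).
Proof.
move=> gX; rewrite -[iter n S]/(iterb S n : X -> X).
move=> /(codim_coordinates gX)[e [phi [C [C0 phiP lift]]]].
exists C => // f; pose f' : dual X := f - \sum_i f (e i) *: phi i.
have f'E x : f' x = f x - \sum_i f (e i) *: phi i x.
  by rewrite -[LHS]/(f x - (\sum_i f (e i) *: phi i) x) bop_sumE.
exists f'.
  apply: bopP => x; rewrite !iter_dual f'E big1 ?subr0// => i _.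
  by rewrite phiP scaler0.
apply: nrm_bop_le => [|y]; first by rewrite mulr_ge0// nrm_ge0.
have [v vE vC] := lift y.
have -> : f' y = (iter n (dual_op S) f : dual X) v.
  rewrite iter_dual f'E {1}vE linearD linear_sum /= -[RHS]addr0 -addrA.
  congr (_ + _).
  rewrite -sumrB big1// => i _.
  by rewrite bopZr [_ *: _]mulrC subrr.
rewrite (le_trans (nrm_bop _ _))// [leRHS]mulrAC [leRHS]mulrC.
by rewrite ler_wpM2l ?nrm_ge0.
Qed.

(** R(S^(n+1)) is the common kernel of its coordinate functionals.  These are
    killed by the (n+1)-st power of the dual operator, hence by its n-th power,
    which says that they vanish on R(S^n). *)
Lemma dual_ascent_range m n :
  geo_complete X -> has_codim (range (iter n.+1 S)) m ->
  null_space (iter n (dual_op S)) = null_space (iter n.+1 (dual_op S)) ->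
  range (iter n S) = range (iter n.+1 S).
Proof.
move=> gX; rewrite -[iter n.+1 S]/(iterb S n.+1 : X -> X).
move=> /(codim_coordinates gX)[e [phi [C [_ phiP lift]]]] eqN.
apply/seteqP; split; last by have := @iter_range _ _ S n 1; rewrite addn1.
move=> _ [x _ <-]; have [v vE _] := lift (iter n S x); exists v => //.
rewrite [RHS]vE big1 ?addr0// => i _.
suff -> : phi i (iter n S x) = 0 by rewrite scale0r.
rewrite -iter_dual; suff : null_space (iter n (dual_op S)) (phi i) by move=> ->.
rewrite eqN; apply: bopP => y; rewrite iter_dual; exact: phiP.
Qed.

End Dual.

(** * Index zero *)

Section Dimension.
Variables (R : realType) (X : normedModType (Cplx R)).
Implicit Types (V : set X).

(** Spanning and independence separately; this is how dimensions are used from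
    here on. *)
Lemma has_dimE V n : subsp V -> has_dim V n ->
  exists e : 'I_n -> X, [/\ forall c, V (lincomb e c),
    forall x, V x -> exists c, x = lincomb e c &
    forall c, lincomb e c = 0 -> c = 0].
Proof.
move=> sV [e [eV eP]]; exists e; split.
- by move=> c; exact: subsp_sum.
- by move=> x /eP[c [xE _]]; exists c.
- move=> c c0; have [d [_ dU]] := eP 0 sV.1.
  by rewrite -(dU c) ?c0//; apply: dU; rewrite -[RHS]/(lincomb e 0) linear0.
Qed.

Lemma has_dimI V n (e : 'I_n -> X) : (forall i, V (e i)) ->
  (forall x, V x -> exists c, x = lincomb e c) ->
  (forall c, lincomb e c = 0 -> c = 0) -> has_dim V n.
Proof.
move=> eV gen free; exists e; split=> // x /gen[c ->].
exists c; split=> // d cd.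
by apply/eqP; rewrite -subr_eq0; apply/eqP/free; rewrite linearB /= cd subrr.
Qed.

Lemma has_codimE V n : subsp V -> has_codim V n ->
  exists e : 'I_n -> X, (forall x, exists c, V (x - lincomb e c)) /\
    (forall c, V (lincomb e c) -> c = 0).
Proof.
move=> sV [e eP]; exists e; split.
  by move=> x; have [c [xc _]] := eP x; exists c.
move=> c Vc; have [d [_ dU]] := eP (lincomb e c).
rewrite -(dU c) ?subrr; last exact: sV.1.
by apply: dU; rewrite -[\sum_(_ < _) _]/(lincomb e 0) linear0 subr0.
Qed.

Lemma has_codimI V n (e : 'I_n -> X) : subsp V ->
  (forall x, exists c, V (x - lincomb e c)) ->
  (forall c, V (lincomb e c) -> c = 0) -> has_codim V n.
Proof.
move=> [V0 VD] gen free; exists e => x; have [c xc] := gen x.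
exists c; split=> // d xd.
apply/eqP; rewrite -subr_eq0; apply/eqP/free; rewrite linearB /=.
by have := VD (-1) _ _ xc xd; rewrite scaleN1r opprB addrA subrK.
Qed.

Definition join_fam m n (e : 'I_m -> X) (f : 'I_n -> X) (i : 'I_(m + n)) : X :=
  match fintype.split i with inl a => e a | inr b => f b end.

Lemma lincomb_join m n (e : 'I_m -> X) (f : 'I_n -> X) c d :
  lincomb (join_fam e f) (row_mx c d) = lincomb e c + lincomb f d.
Proof.
rewrite /lincomb big_split_ord /=; congr (_ + _); apply: eq_bigr => i _.
  by rewrite /join_fam (unsplitK (inl i)) row_mxEl.
by rewrite /join_fam (unsplitK (inr i)) row_mxEr.
Qed.

Lemma lincomb_delta n (e : 'I_n -> X) i : lincomb e (delta_mx 0 i) = e i.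
Proof.
rewrite /lincomb (bigD1 i)//= mxE !eqxx scale1r big1 ?addr0// => j ji.
by rewrite mxE (negbTE ji) andbF scale0r.
Qed.

Lemma lincomb_mulmx m n (e : 'I_n -> X) (A : 'M[Cplx R]_(m, n)) c :
  lincomb (fun i => lincomb e (row i A)) c = lincomb e (c *m A).
Proof.
rewrite mulmx_sum_row linear_sum; apply: eq_bigr => i _.
by rewrite linearZ.
Qed.

Lemma linear_lincomb (Z : normedModType (Cplx R)) (S : bop X Z) n
    (e : 'I_n -> X) c :
  S (lincomb e c) = lincomb (S \o e) c.
Proof. by rewrite linear_sum; apply: eq_bigr => i _; rewrite linearZ. Qed.

End Dimension.

Section IndexZero.
Variables (R : realType) (X : normedModType (Cplx R)).
Implicit Types (S P : bop X X).

(** Equality of the two dimensions is the algebraic content of being Weyl. *)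
Definition index0 S : Prop :=
  exists k, has_dim (null_space S) k /\ has_codim (range S) k.

Lemma weyl_index0 S : weyl S <-> index0 S.
Proof.
split=> [[_ [n [m [dn cm nm]]]]|[k [dk ck]]].
  exists n; split=> //; suff -> : n = m by [].
  by move/eqP: nm; rewrite eq_sym subr_eq0 => /eqP [].
by split; [split; exists k | exists k, k; split=> //; rewrite subrr].
Qed.

(** N(SP) is an extension of N(S) /\ R(P) by N(P); K lists the coordinates of
    N(S) /\ R(P) in a basis of N(S). *)
Lemma null_space_comp S P k k' r (e : 'I_k -> X) (K : 'M[Cplx R]_(r, k)) :
  (forall x, S x = 0 <-> exists c, x = lincomb e c) ->
  (forall c, lincomb e c = 0 -> c = 0) ->
  has_dim (null_space P) k' -> row_free K ->
  (forall c, range P (lincomb e c) <-> (c <= K)%MS) ->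
  has_dim (null_space (compb S P)) (k' + r).
Proof.
move=> Se efree /(has_dimE (subsp_null_space P))[e' [e'N e'gen e'free]].
move=> Kfree KP.
have pex i : exists p, P p = lincomb e (row i K).
  by have /KP[p _ pE] := row_sub i K; exists p.
have [p pP] := choice pex.
have Pp d : P (lincomb p d) = lincomb e (d *m K).
  rewrite linear_lincomb -lincomb_mulmx; apply: eq_bigr => i _.
  by rewrite /= pP.
have Pe' c : P (lincomb e' c) = 0 by exact: e'N.
apply: (has_dimI (e := join_fam e' p)).
- have NE c d : compb S P (lincomb e' c + lincomb p d) = 0.
    by rewrite /= linearD /= Pe' add0r Pp; apply/Se; exists (d *m K).
  move=> i; rewrite /null_space /= /join_fam; case: (fintype.split i) => j.
    by rewrite -(lincomb_delta e') Pe' linear0.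
  by rewrite pP; apply/Se; exists (row j K).
- move=> x /Se[c xc].
  have /submxP[d cd] : (c <= K)%MS by apply/KP; rewrite -xc; exists x.
  have [|c' xE] := e'gen (x - lincomb p d).
    by rewrite /null_space /= linearB /= Pp xc cd subrr.
  by exists (row_mx c' d); rewrite lincomb_join -xE subrK.
- move=> cd; rewrite -[cd]hsubmxK lincomb_join.
  set c := lsubmx cd; set d := rsubmx cd.
  move=> cd0; have d0 : d = 0.
    have := congr1 P cd0; rewrite linearD /= Pe' add0r Pp linear0 => /efree.
    by move=> /eqP; rewrite -(mul0mx _ K) => /eqP /(row_free_inj Kfree).
  move: cd0; rewrite d0 linear0 addr0 => /e'free ->; exact: row_mx0.
Qed.

Lemma null_space_lincomb S k (e : 'I_k -> X) :
  (forall c, null_space S (lincomb e c)) ->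
  (forall x, null_space S x -> exists c, x = lincomb e c) ->
  forall x, S x = 0 <-> exists c, x = lincomb e c.
Proof. by move=> eN egen x; split=> [/egen//|[c ->]]; exact: eN. Qed.

(** The matrix of the map from the span of e to X / R(P). *)
Lemma transition_mx P k k' (e : 'I_k -> X) (f : 'I_k' -> X) :
  (forall x, exists c, range P (x - lincomb f c)) ->
  exists G : 'M[Cplx R]_(k, k'),
    forall c, range P (lincomb e c - lincomb f (c *m G)).
Proof.
move=> fgen; have [g gP] := choice (fun i => fgen (e i)).
exists (\matrix_i g i) => c; rewrite -lincomb_mulmx -sumrB.
under eq_bigr do rewrite -scalerBr rowK.
by apply: subsp_sum => //; exact: subsp_range.
Qed.

(** Let G be the matrix of the map from N(S) to X / R(P).  Then N(SP) is N(P)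
    extended by ker G, and X / R(SP) is X / R(S) extended by coker G; with
    dim N(P) = codim R(P) = k' and dim N(S) = codim R(S) = k, both have
    dimension k + k' - rank G. *)
Lemma index0_comp S P : index0 S -> index0 P -> index0 (compb S P).
Proof.
move=> [k [/(has_dimE (subsp_null_space S))[e [eN egen efree]]]].
move=> /(has_codimE (subsp_range S))[f [fgen ffree]].
move=> [k' [dP]] /(has_codimE (subsp_range P))[f' [f'gen f'free]].
have [G GP] := transition_mx e f'gen.
have [R0 RD] := subsp_range P.
have rangeG c : range P (lincomb e c) -> c *m G = 0.
  move=> Pc; apply: f'free.
  by have := RD (-1) _ _ (GP c) Pc; rewrite scaleN1r opprB subrK.
have Gsub a d : range P (lincomb f' d - lincomb e a) -> d = a *m G.
  move=> h; apply/eqP; rewrite -subr_eq0; apply/eqP/f'free; rewrite linearB /=.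
  by have := RD 1 _ _ (GP a) h; rewrite scale1r addrC addrA subrK.
pose K := row_base (kermx G); pose Q := row_base (G^C)%MS.
have dimN : has_dim (null_space (compb S P)) (k' + \rank (kermx G)).
  apply: (@null_space_comp _ _ _ _ _ e K) => //.
  - exact: null_space_lincomb.
  - exact: row_base_free.
  - move=> c; rewrite /K eq_row_base; split=> [/rangeG cG|/sub_kermxP cG].
      exact/sub_kermxP.
    by have := GP c; rewrite cG linear0 subr0.
have codimR : has_codim (range (compb S P)) (k + \rank (G^C)%MS).
  apply: (has_codimI (e := join_fam f (fun i => S (lincomb f' (row i Q))))).
  - exact: subsp_range.
  - move=> y; have [c [v _ vE]] := fgen y; have [d [w _ wE]] := f'gen v.
    have /sub_addsmxP[[a b'] /= dE] : (d <= G + G^C)%MS.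
      by apply: submx_full; exact: addsmx_compl_full.
    have /submxP[b bE] : (b' *m G^C <= Q)%MS by rewrite eq_row_base submxMl.
    have [u _ uE] := GP a.
    exists (row_mx c b); exists (w - u) => //.
    rewrite lincomb_join -(linear_lincomb S (fun i => lincomb f' (row i Q))).
    rewrite lincomb_mulmx.
    rewrite opprD addrA -vE -bE /= linearB /= wE uE.
    have -> : v - lincomb f' d - (lincomb e a - lincomb f' (a *m G)) =
        v - lincomb f' (b' *m (G^C)%MS) - lincomb e a.
      by rewrite dE linearD /= opprB [X in v - X]addrC opprD !addrA subrK.
    by rewrite linearB /= eN subr0 linearB.
  - move=> cb; rewrite -[cb]hsubmxK lincomb_join.
    set c := lsubmx cb; set b := rsubmx cb.
    rewrite -(linear_lincomb S (fun i => lincomb f' (row i Q))) lincomb_mulmx.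
    move=> [w _ /= wE]; have c0 : c = 0.
      apply: ffree; exists (P w - lincomb f' (b *m Q)) => //.
      by rewrite linearB /= wE addrK.
    have [|a aE] := egen (lincomb f' (b *m Q) - P w).
      by rewrite /null_space /= linearB /= wE c0 linear0 add0r subrr.
    have bQ : b *m Q = a *m G.
      by apply: Gsub; rewrite -aE opprB addrCA subrr addr0; exists w.
    have : (b *m Q <= G :&: G^C)%MS.
      rewrite sub_capmx {1}bQ submxMl.
      by have := submxMl b Q; rewrite /Q eq_row_base.
    rewrite capmx_compl submx0 => /eqP bQ0.
    suff -> : b = 0 by rewrite c0; exact: row_mx0.
    apply: (row_free_inj (row_base_free (G^C)%MS)).
    by rewrite mul0mx.
exists (k' + \rank (kermx G))%N; split=> //.
suff -> : (k' + \rank (kermx G) = k + \rank (G^C)%MS)%N by [].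
rewrite mxrank_ker mxrank_compl.
have := rank_leq_row G; have := rank_leq_col G; move: (\rank G) => g h1 h2.
by rewrite addnBA// addnBA// addnC.
Qed.

Lemma index0_iter S n : index0 S -> index0 (iterb S n).
Proof.
move=> S0; elim: n => [|n IH]; last exact: (index0_comp S0 IH).
have v0 (c : 'rV[Cplx R]_0) : c = 0 by apply/rowP => -[].
exists 0; split.
  apply: (has_dimI (e := fun _ => 0)) => [[]//|x /= xE|c _]; last exact: v0.
  by exists 0; rewrite linear0.
apply: (has_codimI (e := fun _ => 0)) => [|x|c _]; last exact: v0.
  exact: subsp_range.
by exists 0; exists (x - lincomb (fun=> 0) (0 : 'rV[Cplx R]_0)).
Qed.

(** Either side says that the square matrix of the map from N(P) to X / R(P) is
    invertible: the left side is its injectivity, the right side its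
    surjectivity. *)
Lemma index0_square P : index0 P ->
  (forall x, P (P x) = 0 -> P x = 0) <-> (forall x, exists y, P x = P (P y)).
Proof.
move=> [k [/(has_dimE (subsp_null_space P))[e [eN egen efree]]]].
move=> /(has_codimE (subsp_range P))[f [fgen ffree]].
have [G GP] := transition_mx e fgen.
have [R0 RD] := subsp_range P.
split=> [asc x|desc x PPx].
  have Gfree : row_free G.
    rewrite -kermx_eq0; apply/eqP/row_matrixP => i; rewrite row0; apply: efree.
    have := GP (row i (kermx G)); rewrite -row_mul mulmx_ker row0 linear0 subr0.
    move=> [v _ vE]; rewrite -vE; apply: asc; rewrite vE; exact: eN.
  have Gu : G \in unitmx by rewrite -row_free_unit.
  have [c [v _ vE]] := fgen x.
  have [u _ uE] := GP (c *m invmx G); rewrite mulmxKV// in uE.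
  exists (v - u); rewrite -[x](subrK (lincomb f c)) -vE.
  have -> : lincomb f c = lincomb e (c *m invmx G) - P u.
    by rewrite uE opprB addrC subrK.
  by rewrite addrCA linearD /= eN add0r; congr (P _); exact/esym/linearB.
have Gfull : row_full G.
  rewrite -sub1mx; apply/row_subP => i; set c := row i _.
  have [y yE] := desc (lincomb f c).
  have [|a aE] := egen (lincomb f c - P y).
    by rewrite /null_space /= linearB /= yE subrr.
  suff -> : c = a *m G by exact: submxMl.
  apply/eqP; rewrite -subr_eq0; apply/eqP/ffree; rewrite linearB /=.
  have Py : range P (P y) by exists y.
  by have := RD 1 _ _ (GP a) Py; rewrite scale1r -aE addrAC subrK.
have [a aE] := egen (P x) PPx.
have : a *m G = 0.
  apply: ffree.
  have Px : range P (lincomb e a) by rewrite -aE; exists x.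
  by have := RD (-1) _ _ (GP a) Px; rewrite scaleN1r opprB subrK.
have Gu : G \in unitmx by rewrite -row_full_unit.
move=> /(congr1 (mulmx^~ (invmx G))); rewrite mulmxK// mul0mx aE => ->.
exact: linear0.
Qed.

End IndexZero.

(** * Ascent, descent and poles *)

Lemma inf_natP (P : nat -> Prop) : inf_nat P <> None <-> exists n, P n.
Proof.
rewrite /inf_nat; case: pselect => [h|nh]; split=> //.
- by move=> _; have [n /asboolP Pn] := h; exists n.
- by move=> [n Pn]; case: nh; exists n; apply/asboolP.
Qed.

Section AscentDescent.
Variables (R : realType) (X : normedModType (Cplx R)) (S : bop X X).

Lemma null_space_stable n m x :
  null_space (iter n S) = null_space (iter n.+1 S) ->
  iter (n + m) S x = 0 -> iter n S x = 0.
Proof.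
move=> eqN; elim: m x => [|m IH] x; first by rewrite addn0.
rewrite addnS -addSn iterD => h; apply: IH; rewrite iterD.
suff : null_space (iter n S) (iter m S x) by [].
by rewrite eqN.
Qed.

Lemma range_stable n m x :
  range (iter n S) = range (iter n.+1 S) ->
  exists y, iter n S x = iter (n + m) S y.
Proof.
move=> eqR; elim: m => [|m [y xy]]; first by exists x; rewrite addn0.
have : range (iter n S) (iter n S y) by exists y.
rewrite eqR => -[z _ zE]; exists z.
by rewrite addnS -addSn addnC iterD zE -iterD addnC.
Qed.

Lemma ascent_square n : null_space (iter n S) = null_space (iter n.+1 S) ->
  forall m, (n <= m)%N ->
  forall x, iterb S m (iterb S m x) = 0 -> iterb S m x = 0.
Proof.
move=> eqN m nm x; rewrite /= -(subnKC nm) addnC !iterD -!iterD => h.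
suff h' : iter n S x = 0 by rewrite iterD h' iter_0.
apply: (@null_space_stable n (m - n + n + (m - n))) => //.
by rewrite addnC.
Qed.

Lemma descent_square n : range (iter n S) = range (iter n.+1 S) ->
  forall m, (n <= m)%N ->
  forall x, exists y, iterb S m x = iterb S m (iterb S m y).
Proof.
move=> eqR m nm x; have [y xy] := @range_stable n m x eqR; exists y.
by rewrite /= -{1}(subnK nm) iterD xy -!iterD addnA subnK.
Qed.

Lemma square_ascent m : (0 < m)%N ->
  (forall x, iterb S m (iterb S m x) = 0 -> iterb S m x = 0) ->
  ascent S <> None.
Proof.
move=> m0 h; apply/inf_natP; exists m; apply/seteqP; split.
  by rewrite -addn1; exact: iter_null_space.
move=> x Smx; apply: h; rewrite /= -iterD -{1}(prednK m0) addSnnS.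
by rewrite iterD Smx iter_0.
Qed.

Lemma square_descent m : (0 < m)%N ->
  (forall x, exists y, iterb S m x = iterb S m (iterb S m y)) ->
  descent S <> None.
Proof.
move=> m0 h; apply/inf_natP; exists m; apply/seteqP; split.
  move=> _ [x _ <-]; have [y xy] := h x; exists (iter m.-1 S y) => //.
  rewrite -[RHS]/(iterb S m x) xy -[RHS]/(iter m S (iter m S y)).
  by rewrite -!iterD addSnnS prednK.
by rewrite -addn1; exact: iter_range.
Qed.

(** The power n + 1 rather than n is used because the zeroth power is the
    identity, for which the conditions of [index0_square] hold trivially. *)
Lemma index0_ascent_descent :
  index0 S -> ascent S <> None <-> descent S <> None.
Proof.
move=> S0; split=> /inf_natP[n eqn].
  apply: (@square_descent n.+1) => //; apply/(index0_square (index0_iter _ S0)).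
  exact: ascent_square (leqnSn n).
apply: (@square_ascent n.+1) => //; apply/(index0_square (index0_iter _ S0)).
exact: descent_square (leqnSn n).
Qed.

(** Induction through [null_space_comp], with S^(n+1) read as S after S^n. *)
Lemma has_dim_iter k n : has_dim (null_space S) k ->
  exists d, has_dim (null_space (iterb S n)) d.
Proof.
move=> dS; elim: n => [|n [d IH]].
  exists 0; apply: (has_dimI (e := fun _ => 0)) => [[]//|x /= xE|c _].
    by exists 0; rewrite linear0.
  by apply/rowP => -[].
have [e [eN egen efree]] := has_dimE (subsp_null_space S) dS.
have [|A AP] := @subsp_mx _ k [set c | range (iterb S n) (lincomb e c)].
  have [R0 RD] := subsp_range (iterb S n).
  split; first by rewrite /= linear0.
  by move=> a b c Rb Rc; rewrite /= linearP; exact: RD.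
exists (d + \rank A)%N.
apply: (@null_space_comp _ _ S (iterb S n) _ _ _ e (row_base A)) => //.
- exact: null_space_lincomb.
- exact: row_base_free.
- by move=> c; rewrite eq_row_base; exact: AP.
Qed.

(** For P = S^r with r large, X = N(P) + R(P) is direct and S acts on N(P)
    through a square matrix Q.  Here N(S) lies in N(P), so it is ker Q, while
    R(P) lies in R(S), so X / R(S) is coker Q. *)
Lemma pole_index0 k : has_dim (null_space S) k ->
  ascent S <> None -> descent S <> None -> index0 S.
Proof.
move=> dS /inf_natP[p eqp] /inf_natP[q eqq].
pose P := iterb S (maxn p q).+1.
have ascP : forall x, P (P x) = 0 -> P x = 0.
  by apply: (ascent_square eqp); rewrite (leq_trans (leq_maxl p q)).
have desP : forall x, exists y, P x = P (P y).
  by apply: (descent_square eqq); rewrite (leq_trans (leq_maxr p q)).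
have PS x : P (S x) = S (P x) by rewrite /P /= -iterSr.
have SP x : exists y, P x = S y by exists (iter (maxn p q) S x).
have NSP x : S x = 0 -> P x = 0.
  by move=> Sx; rewrite /P -[LHS]/(iter (maxn p q).+1 S x) iterSr Sx iter_0.
have [d dP] : exists d, has_dim (null_space P) d by exact: has_dim_iter dS.
clearbody P; have [e [eN egen efree]] := has_dimE (subsp_null_space P) dP.
have Se i : exists c, S (e i) = lincomb e c.
  apply: egen; rewrite -[null_space P _]/(P (S (e i)) = 0) PS -lincomb_delta.
  by rewrite (eN _ : P _ = 0); exact: linear0.
have [Q0 QP] := choice Se.
pose Q : 'M_d := \matrix_i Q0 i.
have SQ c : S (lincomb e c) = lincomb e (c *m Q).
  rewrite linear_lincomb -lincomb_mulmx; apply: eq_bigr => i _.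
  by rewrite /= QP rowK.
pose K := row_base (kermx Q); pose C := row_base (Q^C)%MS.
exists (\rank (kermx Q)); split.
  apply: (has_dimI (e := fun i => lincomb e (row i K))).
  - move=> i; rewrite /null_space /= SQ.
    have /sub_kermxP -> : (row i K <= kermx Q)%MS.
      by apply: submx_trans (row_sub _ _) _; rewrite eq_row_base.
    exact: linear0.
  - move=> x Sx; have [c xc] := egen x (NSP x Sx).
    have /submxP[b bE] : (c <= K)%MS.
      rewrite eq_row_base; apply/sub_kermxP/efree; rewrite -SQ -xc; exact: Sx.
    by exists b; rewrite lincomb_mulmx -bE.
  - move=> c; rewrite lincomb_mulmx => /efree; rewrite -(mul0mx _ K).
    exact: row_free_inj (row_base_free _) _ _.
rewrite mxrank_ker -mxrank_compl.
apply: (has_codimI (e := fun i => lincomb e (row i C))).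
- exact: subsp_range.
- move=> y; have [z zE] := desP y.
  have [|c cE] := egen (y - P z).
    by rewrite /null_space /= linearB /= zE subrr.
  have /sub_addsmxP[[a b'] /= abE] : (c <= Q + Q^C)%MS.
    by apply: submx_full; exact: addsmx_compl_full.
  have /submxP[b bE] : (b' *m Q^C%MS <= C)%MS by rewrite eq_row_base submxMl.
  exists b; rewrite lincomb_mulmx -bE.
  have [w wE] := SP z; exists (lincomb e a + w) => //.
  rewrite linearD /= SQ -wE; apply/eqP.
  rewrite -subr_eq opprK -addrA [P z + _]addrC addrA.
  by rewrite -linearD /= -abE -cE subrK.
- move=> b; rewrite lincomb_mulmx => -[x _ xE].
  have [z zE] := desP x.
  have [|a aE] := egen (x - P z).
    by rewrite /null_space /= linearB /= zE subrr.
  have PSz : P (S z) = lincomb e (b *m C - a *m Q).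
    rewrite PS linearB /= -xE -SQ -aE linearB /= opprB.
    by rewrite addrCA subrr addr0.
  have bQ : b *m C = a *m Q.
    apply/eqP; rewrite -subr_eq0; apply/eqP/efree; rewrite -PSz.
    by apply: ascP; rewrite PSz; exact: eN.
  have : (b *m C <= Q :&: Q^C)%MS.
    rewrite sub_capmx {1}bQ submxMl.
    by have := submxMl b C; rewrite eq_row_base.
  rewrite capmx_compl submx0 => /eqP bC0.
  by apply: (row_free_inj (row_base_free (Q^C)%MS)); rewrite mul0mx.
Qed.

End AscentDescent.

(** * The extension property outside the Weyl spectrum *)

Section WeylSVEP.
Variables (R : realType) (X : completeNormedModType (Cplx R)).
Variables (T : bop X X) (l : Cplx R).
Hypothesis weylT : weyl (shift T l).

Let gX : geo_complete X.
Proof. exact: banach_geo_complete. Qed.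

Lemma weyl_codim_iter n : exists m, has_codim (range (iter n (shift T l))) m.
Proof.
by have /weyl_index0 /(index0_iter n)[m [_ ?]] := weylT; exists m.
Qed.

Lemma weyl_SVEP_ascent : SVEP_at T l -> ascent (shift T l) <> None.
Proof.
move=> svep; have [k [dN _]] := (weyl_index0 (shift T l)).1 weylT.
have [e [_ egen _]] := has_dimE (subsp_null_space _) dN.
apply/inf_natP; apply: (@no_chain_ascent _ _ _ k e) => [|x|n].
- exact: (SVEP_no_chain gX svep).
- exact: egen.
- have [m cm] := weyl_codim_iter n.
  exact: (@codim_bounded_lift R X (iterb _ n) m gX cm).
Qed.

(** The backward chains now consist of functionals: the ascent argument is
    applied to the dual operator and read off as descent of S. *)
Lemma weyl_dual_SVEP_descent :
  SVEP_at (dual_op T) l -> descent (shift T l) <> None.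
Proof.
move=> svep; have [m1 c1] := weyl_codim_iter 1.
have [phi phiP] := dual_null_span (S := shift T l) gX c1.
have [n eqn] : exists n, null_space (iter n (dual_op (shift T l))) =
    null_space (iter n.+1 (dual_op (shift T l))).
  apply: (@no_chain_ascent _ _ _ m1 phi) => [|//|n].
    rewrite -dual_shift; apply: SVEP_no_chain svep; exact: dual_geo_complete.
  have [m cm] := weyl_codim_iter n; exact: dual_bounded_lift gX cm.
have [m cm] := weyl_codim_iter n.+1.
by apply/inf_natP; exists n; apply: dual_ascent_range gX cm eqn.
Qed.

End WeylSVEP.

Theorem proposition2p14 (R : realType) (X : completeNormedModType (Cplx R))
    (X_infinite_dim : ~ finite_dim [set: X]) (T : bop X X) :
  SVEP_on T (~` weyl_spectrum T) \/ SVEP_on (dual_op T) (~` weyl_spectrum T) ->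
  (property_ZPia T <-> left_poles T = finite_rank_poles T).
Proof.
move=> svep; suff eqP : spectrum T `\` weyl_spectrum T = finite_rank_poles T.
  by rewrite /property_ZPia eqP; split=> ->.
apply/seteqP; split=> l.
  move=> [sl /contrapT wl]; have i0 := (weyl_index0 (shift T l)).1 wl.
  have [aS dS] : ascent (shift T l) <> None /\ descent (shift T l) <> None.
    case: svep => /(_ l (fun h => h wl)) svep.
      have aS := weyl_SVEP_ascent wl svep.
      by split=> //; apply/(index0_ascent_descent i0).
    have dS := weyl_dual_SVEP_descent wl svep.
    by split=> //; apply/(index0_ascent_descent i0).
  by split=> //; case: wl => -[].
move=> [[sl aS dS] [k dN]]; split=> // nw; apply: nw.
by apply/weyl_index0; exact: pole_index0 dN aS dS.
Qed.
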